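(* Let $G$ be a connected $5K_1$-free graph. Then $G$ has a Hamiltonian path if and only if all of the following hold. (a) For every articulation point $x$ of $G$, $G-\{x\}$ has at most 2 components. (b) There are no 3 articulation points of $G$ inducing a triangle in $G$. (c) If $G$ is not 2-connected and $x$ is an articulation point of $G$ such that one component $Q_1$ of $G-\{x\}$ induces a clique and the other component $Q_2$ induces a $4K_1$-free graph, then there exists a vertex $u\in Q_2$ adjacent to $x$ such that $G[Q_2]$ has a Hamiltonian path starting at $u$. (d) If $G$ is 2-connected but not 3-connected, then for every minimum vertex cut $\{x,y\}$ of $G$, $G-\{x,y\}$ has at most 3 components.
   Context: Graphs are finite, simple and undirected. A graph is $kK_1$-free if it contains no $k$ pairwise non-adjacent vertices. $G[A]$ denotes the subgraph induced by $A$. A Hamiltonian path is a path containing all vertices; ''starting at $u$'' means $u$ is an end-vertex. A vertex cut of $H$ is a set $A\subset V(H)$ with $H-A$ disconnected; an articulation point is a vertex $x$ with $H-\{x\}$ disconnected. The vertex connectivity of $H$ is the minimum size of a vertex cut ($|V(H)|-1$ if $H$ is complete); $H$ is $k$-connected if its vertex connectivity is at least $k$; a minimum vertex cut is a vertex cut of size equal to the vertex connectivity. *)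

(* Defs.v *)
From mathcomp Require Import all_boot.

Set Implicit Arguments.
Unset Strict Implicit.
Unset Printing Implicit Defensive.

(* A graph on the finite vertex type T is given by a symmetric and irreflexive
   adjacency relation e.  All notions below are relative to a vertex set S and
   describe the induced subgraph G[S]; the graph G itself is S = [set: T]. *)
Section Graphs.

Variables (T : finType) (e : rel T).
Implicit Types (S A : {set T}) (p : seq T).

Definition induced S : rel T := [rel u v | [&& u \in S, v \in S & e u v]].

Definition connected S : bool :=
  (S != set0) && [forall u in S, forall v in S, connect (induced S) u v].

(* The empty graph is neither connected nor disconnected. *)
Definition disconnected S : bool :=
  [exists u in S, exists v in S, ~~ connect (induced S) u v].

(* The vertex sets of the connected components of G[S]. *)
Definition components S : {set {set T}} :=
  equivalence_partition (connect (induced S)) S.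

Definition clique S : bool :=
  [forall u in S, forall v in S, (u != v) ==> e u v].

Definition independent A : bool :=
  [forall u in A, forall v in A, (u != v) ==> ~~ e u v].

Definition kK1_free (k : nat) S : bool :=
  ~~ [exists A : {set T}, [&& A \subset S, #|A| == k & independent A]].

(* Since p must enumerate S, sorted e p says that p is a path of G[S]. *)
Definition ham_path S p : Prop := [/\ sorted e p, uniq p & p =i S].

Definition has_ham_path S : Prop := exists p, ham_path S p.

(* Paths can be reversed, so the end-vertex u may be taken to come first. *)
Definition has_ham_path_from S u : Prop := exists p, ham_path S (u :: p).

Definition vertex_cut S A : bool := (A \subset S) && disconnected (S :\: A).

Definition articulation_point S x : bool :=
  (x \in S) && disconnected (S :\ x).

(* The default value #|S| of the minimum is never reached: if G[S] is not
   complete, the complement of two non-adjacent vertices is a vertex cut. *)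
Definition vertex_connectivity S : nat :=
  if clique S then #|S|.-1
  else \big[minn/#|S|]_(A : {set T} | vertex_cut S A) #|A|.

Definition k_connected (k : nat) S : bool := k <= vertex_connectivity S.

Definition minimum_vertex_cut S A : bool :=
  vertex_cut S A && (#|A| == vertex_connectivity S).

End Graphs.

(* Main.v *)
(* Suppose that a longest path P misses a vertex, and let H be a component of
   G - P.  No vertex of H sees an end of P, and the first vertex of P, the
   successors on P of the attachments of H and a vertex of H are independent; so H
   has at most two attachments.

   If G has an articulation point x, then either some articulation point cuts off
   a clique, and (c) concludes, or both components of G - x are 3K1-free.  In the
   latter case a longest path of Q + x starting at x covers the component Q:
   otherwise a component H of the rest of Q would be a clique with a single
   attachment in Q, which would be an articulation point cutting off a clique.

   If G has no articulation point, then P = P1 a P2 b P3, with a and b the two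
   attachments of H.  Rerouting P through H and using 5K1-freeness shows that P1,
   P2, P3 are cliques, that P and H cover G, and that no edge joins two of P1, P2,
   P3, H.  Hence G - {a, b} has four components, contradicting (d). *)
Require Import Defs.
From mathcomp Require Import all_boot zify.

Set Implicit Arguments.
Unset Strict Implicit.
Unset Printing Implicit Defensive.

(** Two contradictions recur: a path longer than a longest one, and five pairwise non-adjacent
    vertices, one of them in [H]. A rerouted path is written as a concatenation of pieces of the old
    path and a detour through [H], so that only its junctions and its multiset of vertices have to
    be checked.

    With two attachments, the successor argument yields only four independent vertices: the first
    vertex, the two successors and a vertex of [H]. The obstacle is to find a fifth. Reading the
    path backwards makes the last vertex and the predecessors available too. Moreover, whatever is
    proved for all longest paths with these attachments also holds for the rerouted ones, so an
    unwanted edge produces a new path to which the earlier facts apply.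

    Once the parts are cliques, they can be crossed between any two vertices, and an edge between
    two parts is forced to join prescribed ends. Such an end is not an articulation point, so some
    other edge leaves its part; using both edges gives a longer path. *)

(** * Walks with explicit ends, non-adjacency, components *)

Section Walks.

Variables (T : finType) (e : rel T).
Hypotheses (e_sym : symmetric e) (e_irr : irreflexive e).
Implicit Types (x y z u v w : T) (p q s t : seq T) (A S X : {set T}).

(** Both ends are explicit and [p] lists them, so reversal and concatenation of walks are plain list
    operations. The empty list is excluded. *)
Definition walk u v p : bool :=
  if p is x :: s then [&& x == u, last x s == v & path e x s] else false.

Lemma walk1 u : walk u u [:: u].
Proof. by rewrite /walk /= !eqxx. Qed.

Lemma walk_cat u v w z p q :
  walk u v p -> e v w -> walk w z q -> walk u z (p ++ q).
Proof.
case: p q => // x p [|y q] //= /and3P[/eqP <- /eqP <- Hp] evw.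
case/and3P=> /eqP yw /eqP <- Hq.
by rewrite last_cat cat_path /= Hp yw evw -yw Hq !eqxx.
Qed.

Lemma walk_rev u v p : walk u v p -> walk v u (rev p).
Proof.
elim: p u v => // x [|y p] IH u v /=.
  by case/and3P => /eqP <- /eqP <- _; rewrite /rev /= !eqxx.
case/and3P => /eqP <- /eqP <- /andP[exy Hp].
rewrite rev_cons -cats1; apply: (@walk_cat _ y x); last exact: walk1.
  by apply: IH; rewrite /= !eqxx.
by rewrite e_sym.
Qed.

Lemma walk_head u v p : walk u v p -> u \in p.
Proof. by case: p => // x p /and3P[/eqP <- _ _]; rewrite mem_head. Qed.

Lemma walk_last u v p : walk u v p -> v \in p.
Proof. by case: p => // x p /and3P[_ /eqP <- _]; rewrite mem_last. Qed.

Lemma walk_sorted u v p : walk u v p -> sorted e p.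
Proof. by case: p => // x p /and3P[]. Qed.

Lemma walk_headE u v x p : walk u v (x :: p) -> x = u.
Proof. by case/and3P => /eqP. Qed.

Lemma walk_lastE u v x s : walk u v (s ++ [:: x]) -> x = v.
Proof. by case: s => [|y s] /and3P[_ /eqP]; rewrite ?last_cat. Qed.

Lemma sorted_walk x p : sorted e (x :: p) -> walk x (last x p) (x :: p).
Proof. by move=> /= ->; rewrite !eqxx. Qed.

Lemma walk_splitr u v x p : walk u v p -> x \in p -> x != v ->
  exists y s t, [/\ p = s ++ t, walk u x s, e x y & walk y v t].
Proof.
move=> Hw xp xv; case/splitPr: xp Hw => s [|y t].
  case: s => [/and3P[/= _ /eqP xv'] | a s /and3P[_ /eqP]].
    by rewrite xv' eqxx in xv.
  by rewrite last_cat /= => xv'; rewrite xv' eqxx in xv.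
case: s => [|a s] Hw.
  exists y, [:: x], (y :: t); case/and3P: Hw => /= /eqP -> /eqP -> /andP[-> ->].
  by rewrite !eqxx.
exists y, (a :: rcons s x), (y :: t); case/and3P: Hw => /= /eqP ->.
rewrite last_cat cat_path last_rcons rcons_path /= => /eqP ->.
by case/and4P=> -> -> -> ->; rewrite !eqxx cat_rcons.
Qed.

Lemma walk_splitl u v x p : walk u v p -> x \in p -> x != u ->
  exists y s t, [/\ p = s ++ t, walk u y s, e y x & walk x v t].
Proof.
move=> /walk_rev Hw xp xv.
have [|y [s [t [Ep H1 H2 H3]]]] := walk_splitr Hw _ xv; first by rewrite mem_rev.
exists y, (rev t), (rev s); split; rewrite 1?e_sym //; try exact: walk_rev.
by rewrite -rev_cat -Ep revK.
Qed.

(** Distinctness is built in, so [pairwise nadj] alone says that a list enumerates an independent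
    set without repetition. *)
Definition nadj : rel T := [rel x y | (x != y) && ~~ e x y].

Lemma nadj_sym : symmetric nadj.
Proof. by move=> x y; rewrite /nadj /= eq_sym e_sym. Qed.

Lemma nadjPn x y : ~~ nadj x y -> x = y \/ e x y.
Proof. by rewrite negb_and !negbK => /orP[/eqP|]; [left | right]. Qed.

Lemma free_nadj k S s : kK1_free e k S -> {subset s <= S} -> size s = k ->
  ~~ pairwise nadj s.
Proof.
move=> /existsPn/(_ [set x in s]) Hf sS Hk; apply: contra Hf => Hs.
have Us : uniq s by apply: pairwise_uniq Hs => x; rewrite /nadj /= eqxx.
apply/and3P; split.
- by apply/subsetP=> x; rewrite inE => /sS.
- by rewrite cardsE (card_uniqP Us) Hk.
(* Weakened on the diagonal, the relation is reflexive and symmetric, so [pairwise] extends to all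
   pairs of members. *)
pose r := [rel x y : T | (x != y) ==> ~~ e x y].
have {}Hs : pairwise r s.
  by apply: sub_pairwise Hs => x y /andP[xy Ne]; rewrite /r /= xy.
have rr : reflexive r by move=> x; rewrite /r /= eqxx.
have rs : symmetric r by move=> x y; rewrite /r /= [e x y]e_sym eq_sym.
rewrite (pairwise_all2rel rr rs) in Hs.
apply/forall_inP=> x; rewrite inE => xs; apply/forall_inP=> y; rewrite inE => ys.
by move/allrelP: Hs => /(_ x y xs ys).
Qed.

Definition component S x : {set T} := [set y in S | connect (induced e S) x y].

Lemma componentsP S C :
  reflect (exists2 x, x \in S & C = component S x) (C \in components e S).
Proof. exact: imsetP. Qed.

Lemma connect_induced_sym S : connect_sym (induced e S).
Proof. by apply: sym_connect_sym => x y; rewrite /induced /= e_sym andbCA. Qed.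

Lemma component_sub S x : component S x \subset S.
Proof. by apply/subsetP=> y; rewrite inE => /andP[]. Qed.

Lemma component_refl S x : x \in S -> x \in component S x.
Proof. by move=> xS; rewrite inE xS connect0. Qed.

Lemma component_adj S x y z : y \in component S x -> z \in S -> e y z -> z \in component S x.
Proof.
rewrite !inE => /andP[yS xy] zS yz; rewrite zS.
by apply: connect_trans xy (connect1 _); rewrite /induced /= yS zS.
Qed.

Lemma component_eq S x y : y \in component S x -> component S y = component S x.
Proof.
rewrite inE => /andP[yS xy]; apply/setP=> z; rewrite !inE.
by rewrite (same_connect (@connect_induced_sym S) xy).
Qed.

Lemma connect_closed S X x y :
  {in X & S, forall z w, e z w -> w \in X} -> x \in X ->
  connect (induced e S) x y -> y \in X.
Proof.
move=> HX xX /connectP[p Hp ->] {y}; elim: p x xX Hp => //= y p IH x xX.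
by case/andP=> /and3P[_ yS xy] /IH; apply; apply: HX xy.
Qed.

Lemma component_closed S X x :
  {in X & S, forall z w, e z w -> w \in X} -> x \in X -> component S x \subset X.
Proof.
move=> HX xX; apply/subsetP=> y; rewrite inE => /andP[_]; exact: connect_closed.
Qed.

Lemma closed_disconnected S X x y :
  {in X & S, forall z w, e z w -> w \in X} ->
  x \in X -> x \in S -> y \in S -> y \notin X -> disconnected e S.
Proof.
move=> HX xX xS yS yX; apply/exists_inP; exists x => //; apply/exists_inP.
by exists y => //; apply: contra yX; apply: connect_closed.
Qed.

(** Connectivity enters the later arguments in this form; with [S] the graph minus a vertex, it
    yields a neighbour of [X] other than that vertex. *)
Lemma edge_out S X x y : ~~ disconnected e S ->
  x \in X -> x \in S -> y \in S -> y \notin X ->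
  exists z w, [/\ z \in X, w \in S, w \notin X & e z w].
Proof.
move=> Hd xX xS yS yX.
case: (boolP [exists z in X, exists w in S, (w \notin X) && e z w]).
  by case/exists_inP=> z zX /exists_inP[w wS /andP[wX zw]]; exists z, w.
move=> H; case/negP: Hd; apply: (closed_disconnected (X := X)) xX xS yS yX.
move=> z w zX wS zw; apply: contraNT H => wX.
by apply/exists_inP; exists z => //; apply/exists_inP; exists w; rewrite ?wX.
Qed.

Lemma component_walk S x y z : y \in component S x -> z \in component S x ->
  exists q, [/\ walk y z q, uniq q & {subset q <= component S x}].
Proof.
move=> yC zC; have /connectP[p] : connect (induced e S) y z.
  by move: zC; rewrite -(component_eq yC) inE => /andP[].
case/shortenP=> q Hq Uq _ Ez; exists (y :: q); split=> //.
  rewrite /walk -Ez !eqxx /=; apply: sub_path Hq => u v.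
  by rewrite /induced /=; case/and3P.
clear Uq Ez; elim: q y yC Hq => [|w q IH] y yC /=.
  by move=> _ u; rewrite inE => /eqP ->.
case/andP=> /and3P[_ wS yw] Hq u; rewrite inE => /orP[/eqP -> //|].
by apply: IH => //; apply: component_adj yw.
Qed.

Lemma walk_connect S u v p : walk u v p -> {subset p <= S} ->
  {in p, forall x, x \in component S u}.
Proof.
elim: p u => // y p IH u Hw pS x; have Ey := walk_headE Hw; subst y.
have uS : u \in S by rewrite pS ?mem_head.
rewrite inE => /orP[/eqP-> |]; first exact: component_refl.
case: p IH Hw pS => // y p IH /and3P[_ /= Hl /andP[uy Hp]] pS xp.
have pS' : {subset y :: p <= S} by move=> z zp; rewrite pS // inE zp orbT.
have Hy : y \in component S u.
  by apply: component_adj uy; [apply: component_refl | apply: pS'; apply: mem_head].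
by rewrite -(component_eq Hy); apply: IH => //; rewrite /walk Hl Hp eqxx.
Qed.

End Walks.
Arguments walk {T} e u v p : simpl never.

(** Counts an arbitrary predicate on both sides; the [perm_eq] hypotheses of the context become
    linear equations between the counts. *)
Ltac perm_count :=
  let f := fresh in apply/permP => f;
  repeat match goal with
    | H : is_true (perm_eq _ _) |- _ => move: (permP H f); clear H
  end;
  do 3! rewrite /= ?(count_cat, count_rev) /=;
  repeat match goal with
    | |- context [count ?f ?s] => move: (count f s) => ?
    | |- context [nat_of_bool ?b] => move: (nat_of_bool b) => ?
  end; clear; lia.

Ltac edge := first [assumption | match goal with H : symmetric _ |- _ => rewrite H; assumption end].
(** Follows the concatenations in the goal, so the bracketing of the list dictates which pieces are
    looked up in the context. *)
Ltac wlk := first [eassumption | lazymatch goal with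
 | |- is_true (walk _ _ _ (_ ++ _)) => eapply walk_cat; [wlk | | wlk]; edge
 | |- is_true (walk _ _ _ (rev _)) => eapply walk_rev; [eassumption | wlk]
 | |- is_true (walk _ _ _ [:: _]) => apply: walk1
 end].

Ltac nadjs := rewrite /=; repeat match goal with |- is_true (_ && _) => apply/andP; split end;
  first [ assumption
        | match goal with H : symmetric _ |- _ => rewrite (nadj_sym H); assumption end
        | done ].

(** * Necessity of the four conditions *)

Section Necessity.

Variables (T : finType) (e : rel T).
Hypotheses (e_sym : symmetric e) (e_irr : irreflexive e).
Implicit Types (x y z u v w : T) (p q s t : seq T) (A S X : {set T}).

Lemma sorted_comp S p x y : sorted e p -> {subset p <= S} ->
  x \in p -> y \in p -> y \in component e S x.
Proof.
case: p => // a p /sorted_walk Hp pS xp yp.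
have H := walk_connect e_sym Hp pS.
by rewrite (component_eq e_sym (H x xp)) H.
Qed.

Lemma comp_connected S x : S \subset component e S x -> ~~ disconnected e S.
Proof.
move/subsetP=> HS; apply/exists_inP=> -[u uS /exists_inP[v vS]].
move: (HS v vS); rewrite -(component_eq e_sym (HS u uS)) inE => /andP[_ ->] //.
Qed.

Lemma components_cover S (L : seq (seq T)) :
  {in L, forall p, sorted e p /\ {subset p <= S}} ->
  {in S, forall x, exists2 p, p \in L & x \in p} ->
  #|components e S| <= size L.
Proof.
(* A path stays within the component of its first vertex. An empty path contributes [set0], which
   does no harm to an upper bound. *)
move=> HL HS; pose f p := if p is x :: _ then component e S x else set0.
rewrite -(size_map f); apply: leq_trans (card_size _).
apply/subset_leq_card/subsetP=> C /componentsP[x xS ->].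
have [p pL xp] := HS x xS; apply/mapP; exists p => //.
case: p pL xp => // y p pL xp; have [Hp pS] := HL _ pL.
by rewrite /f; apply/esym/(component_eq e_sym)/(sorted_comp Hp); rewrite ?mem_head.
Qed.

Lemma ham_path_cat p x : ham_path e [set: T] p ->
  exists s t, [/\ p = s ++ x :: t, sorted e s, sorted e t,
    [set: T] :\ x =i s ++ t & uniq (s ++ x :: t)].
Proof.
case=> Hp Up Mp; have xp: x \in p by rewrite Mp inE.
move: Hp Up Mp; case/splitPr: xp => s t Hp Up Mp; exists s, t.
have [Hs Ht] := cat_sorted2 Hp; split=> //; first exact: path_sorted Ht.
move=> y; move: Up (Mp y); rewrite cat_uniq /= !(mem_cat, inE) => /and3P[_ xs /andP[xt _]].
case: eqVneq => [-> _|_ ->] //=.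
by rewrite (negPf xt) orbF; apply/esym/negbTE; apply: contra xs => ->.
Qed.

Lemma ham_articulation p x : ham_path e [set: T] p ->
  #|components e ([set: T] :\ x)| <= 2.
Proof.
case/(@ham_path_cat _ x) => s [t [_ Hs Ht Mst _]].
apply: (@components_cover _ [:: s; t]).
  move=> q; rewrite !inE => /orP[]/eqP->; split=> // y yq; rewrite Mst mem_cat yq //.
  by rewrite orbT.
move=> y; rewrite Mst mem_cat => /orP[] yq; [exists s|exists t] => //;
  by rewrite !inE eqxx ?orbT.
Qed.

Lemma ham_cut2 p x y : ham_path e [set: T] p ->
  #|components e ([set: T] :\: [set x; y])| <= 3.
Proof.
move=> Hp; have [<-|xy] := eqVneq x y.
  have -> : [set: T] :\: [set x; x] = [set: T] :\ x by rewrite setUid.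
  by apply: leq_trans (ham_articulation x Hp) _.
have [s [t [_ Hs Ht Mst Ust]]] := ham_path_cat x Hp.
have M z : (z \in [set: T] :\: [set x; y]) = (z != y) && (z \in s ++ t).
  by rewrite -Mst !inE; case: (z == y); rewrite ?orbT ?orbF ?andbT.
have split3 q : sorted e q -> exists q1 q2,
   [/\ sorted e q1, sorted e q2 & uniq q -> forall z, (z \in q1 ++ q2) = (z != y) && (z \in q)].
  move=> Hq; have [yq|yq] := boolP (y \in q); last first.
    exists q, [::]; split=> // _ z; rewrite cats0.
    by case: eqVneq => // ->; apply/negbTE.
  case/splitPr: yq Hq => q1 q2 Hq; exists q1, q2.
  have [H1 H2] := cat_sorted2 Hq; split=> //; first exact: path_sorted H2.
  rewrite cat_uniq /= => /and3P[_ H /andP[Hy _]] z; rewrite !mem_cat inE.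
  case: eqVneq => [->|] //=; apply/negbTE; rewrite negb_or Hy andbT.
  by apply: contra H => ->.
have yst : y \in s ++ t by rewrite -Mst !inE eq_sym xy.
have [Us Ut] : uniq s /\ uniq t.
  by move: Ust; rewrite cat_uniq /= => /and3P[-> _ /andP[_ ->]].
have gen a b : sorted e a -> sorted e b -> uniq a -> y \in a -> y \notin b ->
   (forall z, (z \in s ++ t) = (z \in a) || (z \in b)) ->
   #|components e ([set: T] :\: [set x; y])| <= 3.
  move=> Ha Hb Ua ya yb Mab.
  have [q1 [q2 [H1 H2 /(_ Ua) H3]]] := split3 a Ha.
  have Ny z : z \in b -> z != y by move=> zb; apply: contraNneq yb => <-.
  apply: (@components_cover _ [:: q1; q2; b]).
    move=> q; rewrite !inE => /or3P[]/eqP->; split=> // z zq; rewrite M Mab.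
    - by move: (H3 z); rewrite mem_cat zq => /esym/andP[-> ->].
    - by move: (H3 z); rewrite mem_cat zq orbT => /esym/andP[-> ->].
    - by rewrite zq orbT Ny.
  move=> z; rewrite M Mab => /andP[zy /orP[]zq].
    move: (H3 z); rewrite zq zy mem_cat => /orP[] ?; [exists q1|exists q2] => //;
      by rewrite !inE eqxx ?orbT.
  by exists b => //; rewrite !inE eqxx ?orbT.
have dis z : z \in s -> z \notin t.
  move=> zs; move: Ust; rewrite cat_uniq => /and3P[_ /hasPn H _].
  by apply/negP=> zt; move: (H z); rewrite inE zt orbT zs => /(_ isT).
move: yst; rewrite mem_cat => /orP[] yq.
  by apply: (gen s t) => //; [apply: dis | move=> z; rewrite mem_cat].
by apply: (gen t s) => //; [apply: contraTN yq; apply: dis | move=> z; rewrite mem_cat orbC].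
Qed.

(** The edge [x z] reconnects the two pieces left by deleting [y]. In a triangle, the vertex met
    second on the path is bypassed in this way by the edge between the other two. *)
Lemma ham_no_bypass p x y z : ham_path e [set: T] p -> e x z ->
  index x p < index y p -> index y p < index z p ->
  ~~ articulation_point e [set: T] y.
Proof.
move=> Hp xz; have [s [t [-> Hs Ht Mst Ust]]] := ham_path_cat y Hp.
have ys : y \notin s by move: Ust; rewrite cat_uniq => /and3P[_ /norP[]].
have -> : index y (s ++ y :: t) = size s.
  by rewrite index_cat (negPf ys) /= eqxx addn0.
move=> ix iz.
have xs : x \in s by move: ix; rewrite index_cat; case: (x \in s) => //; rewrite ltnNge leq_addr.
have zs : z \notin s.
  apply/negP=> zs; move: iz; rewrite index_cat zs ltnNge.
  by rewrite ltnW // index_mem.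
have zt : z \in t.
  have := Mst z; rewrite mem_cat (negPf zs) !inE andbT /= => <-.
  by apply: contraTneq iz => ->; rewrite index_cat (negPf ys) /= eqxx addn0 ltnn.
apply/nandP; right; apply: (@comp_connected _ x).
have sS : {subset s <= [set: T] :\ y} by move=> w; rewrite Mst mem_cat => ->.
have tS : {subset t <= [set: T] :\ y}.
  by move=> w; rewrite Mst mem_cat orbC => ->.
have zC : z \in component e ([set: T] :\ y) x.
  by apply: component_adj xz; [apply/component_refl/sS | apply: tS].
apply/subsetP=> w; rewrite Mst mem_cat => /orP[ws|wt].
  exact: sorted_comp Hs sS xs ws.
by rewrite -(component_eq e_sym zC); apply: sorted_comp Ht tS zt wt.
Qed.

Lemma ham_no_articulation_triangle p x y z : ham_path e [set: T] p ->
  articulation_point e [set: T] x -> articulation_point e [set: T] y ->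
  articulation_point e [set: T] z -> e x y -> e y z -> e x z -> False.
Proof.
move=> Hp ax ay az xy yz xz; have [_ _ Mp] := Hp.
have ne a b : e a b -> index a p <> index b p.
  by move=> ab /index_inj Eab; rewrite Eab ?Mp ?inE // e_irr in ab.
have N a b c : articulation_point e [set: T] b -> e a c ->
    ~ (index a p < index b p < index c p).
  move=> ab ac /andP[i1 i2]; by move: (ham_no_bypass Hp ac i1 i2); rewrite ab.
have [yx [zy zx]] : [/\ e y x & (e z y /\ e z x)] by rewrite e_sym xy e_sym yz e_sym.
move: (N _ _ _ ax yz) (N _ _ _ ax zy) (N _ _ _ ay xz) (N _ _ _ ay zx).
move: (N _ _ _ az xy) (N _ _ _ az yx) (ne _ _ xy) (ne _ _ yz) (ne _ _ xz).
lia.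
Qed.

(** Each of the two pieces of [p] around [x] stays in one component. As there are two components,
    each piece is a whole one, and the piece equal to [Q2] has its end next to [x] adjacent to
    [x]. *)
Lemma ham_pendant p x (Q1 Q2 : {set T}) : ham_path e [set: T] p ->
  Q1 != Q2 -> components e ([set: T] :\ x) = [set Q1; Q2] ->
  exists u : T, [/\ u \in Q2, e x u & has_ham_path_from e Q2 u].
Proof.
move=> Hp Q12 HQ; set S := [set: T] :\ x in HQ.
have /componentsP[w wS Ew] : Q2 \in components e S by rewrite HQ !inE eqxx orbT.
have /componentsP[w' w'S Ew'] : Q1 \in components e S by rewrite HQ !inE eqxx.
have main s t : sorted e s -> sorted e (x :: t) -> S =i s ++ t -> uniq t -> w \in t ->
    exists u : T, [/\ u \in Q2, e x u & has_ham_path_from e Q2 u].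
  move=> Hs Hxt Mst Ut wt; have Ht := path_sorted Hxt.
  have sS : {subset s <= S} by move=> z; rewrite Mst mem_cat => ->.
  have tS : {subset t <= S} by move=> z; rewrite Mst mem_cat orbC => ->.
  have tQ z : z \in t -> z \in Q2 by rewrite Ew; apply: sorted_comp.
  have w't : w' \notin t.
    by apply: contra Q12 => w't; rewrite Ew' Ew (component_eq e_sym (sorted_comp Ht tS wt w't)).
  have w's : w' \in s by move: w'S; rewrite Mst mem_cat (negPf w't) orbF.
  have Qt : t =i Q2.
    move=> z; apply/idP/idP; first exact: tQ.
    move=> zQ; have: z \in S by move: zQ; rewrite Ew inE => /andP[].
    rewrite Mst mem_cat => /orP[zs|//]; case/negP: Q12; rewrite Ew Ew'.
    have := sorted_comp Hs sS w's zs; rewrite Ew in zQ.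
    by move/(component_eq e_sym) <-; rewrite (component_eq e_sym zQ).
  case: t Hxt Ut Ht wt Qt {Mst tS tQ w't} => // u t /= /andP[xu _] Ut Ht wt Qt.
  exists u; split=> //; first by rewrite -Qt mem_head.
  by exists t; split.
have [s [t [Ep Hs Ht Mst Ust]]] := ham_path_cat x Hp.
have [Hp' _ _] := Hp; rewrite Ep in Hp'.
have [_ Hxt] := cat_sorted2 Hp'.
move: Ust; rewrite cat_uniq /= => /and3P[Us _ /andP[_ Ut]].
have := wS; rewrite Mst mem_cat => /orP[ws|wt]; last exact: (main s t).
(* Here [Q2] comes before [x], so the path is read backwards. *)
apply: (main t (rev s)); rewrite ?rev_uniq ?mem_rev //.
  rewrite -rev_rcons rev_sorted.
  have -> : sorted (fun z => e^~ z) (rcons s x) = sorted e (rcons s x).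
    by apply: eq_sorted => a b; rewrite /= e_sym.
  by move: Hp'; rewrite -cat_rcons => /cat_sorted2[].
by move=> z; rewrite Mst !mem_cat mem_rev orbC.
Qed.

End Necessity.

(** * Longest paths, and paths in cliques *)

Section Longest.

Variables (T : finType) (e : rel T).
Hypotheses (e_sym : symmetric e) (e_irr : irreflexive e).
Implicit Types (x y z u v w : T) (p q s t : seq T) (A S X : {set T}).

(** Through tuples, the existence of a list of length [n] satisfying [P] is a boolean; uniqueness of
    entries bounds [n] by [#|T|]. *)
Lemma longest_uniq (P : pred (seq T)) s0 :
  P s0 -> (forall s, P s -> uniq s) ->
  exists2 s, P s & forall s', P s' -> size s' <= size s.
Proof.
move=> P0 HP; pose R n := [exists t : n.-tuple T, P t].
have RP s : P s -> R (size s) by move=> Ps; apply/existsP; exists (in_tuple s).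
have R0 : exists n, R n by exists (size s0); apply: RP.
have Rle n : R n -> n <= #|T|.
  by case/existsP=> t /HP Ut; rewrite -(size_tuple t) -(card_uniqP Ut) max_card.
case: (ex_maxnP R0 Rle) => n /existsP[t Pt] max; exists t => // s' /RP/max.
by rewrite size_tuple.
Qed.

Lemma walk_catE u v s t : walk e u v (s ++ t) -> s != [::] -> t != [::] ->
  exists y z, [/\ walk e u y s, e y z & walk e z v t].
Proof.
rewrite /walk; case: s t => // x s [|y t] //= /and3P[xu Hl Hp] _ _.
move: Hl Hp; rewrite last_cat cat_path /= => Hl /and3P[Hs Hy Ht].
by exists (last x s), y; rewrite xu Hl Hs Ht !eqxx.
Qed.

Lemma clique_sorted p : uniq p -> {in p &, forall x y, x != y -> e x y} -> sorted e p.
Proof.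
rewrite uniq_pairwise => Up Hp; apply: pairwise_sorted.
apply: (sub_in_pairwise (P := [in p])) Up; last exact/allP.
by move=> x y xp yp /=; apply: Hp.
Qed.

Lemma clique_walk_from p u : uniq p -> {in p &, forall x y, x != y -> e x y} ->
  u \in p -> exists v q, [/\ v \in p, walk e u v q & perm_eq q p].
Proof.
move=> Up Hp up; have Hq : perm_eq (u :: rem u p) p by rewrite perm_sym perm_to_rem.
exists (last u (rem u p)), (u :: rem u p); split=> //.
  by rewrite -(perm_mem Hq) mem_last.
apply: sorted_walk; apply: clique_sorted; first by rewrite (perm_uniq Hq).
by move=> x y; rewrite !(perm_mem Hq); apply: Hp.
Qed.

Lemma clique_walk p u v : uniq p -> {in p &, forall x y, x != y -> e x y} ->
  u \in p -> v \in p -> u != v -> exists2 q, walk e u v q & perm_eq q p.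
Proof.
move=> Up Hp up vp uv.
have Hv : perm_eq (v :: rem v p) p by rewrite perm_sym perm_to_rem.
have Uv := rem_uniq v Up.
have uv' : u \in rem v p by rewrite mem_rem_uniq // inE uv.
have [|w [q [wq Hq Pq]]] := clique_walk_from Uv _ uv'.
  by move=> x y /mem_rem xp /mem_rem yp; apply: Hp.
exists (q ++ [:: v]); last by rewrite perm_catC /=; apply: perm_trans Hv; rewrite perm_cons.
apply: walk_cat Hq _ (walk1 e v); move: wq; rewrite mem_rem_uniq // inE => /andP[wv wp].
exact: Hp.
Qed.

End Longest.

(** * Vertex connectivity and small cuts *)

Section Connectivity.

Variables (T : finType) (e : rel T).
Hypotheses (e_sym : symmetric e) (e_irr : irreflexive e).
Implicit Types (x y z u v w : T) (p q s t : seq T) (A S X : {set T}).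

Lemma vertex_cut_nonclique A : vertex_cut e [set: T] A -> ~~ clique e [set: T].
Proof.
case/andP=> _ /exists_inP[u uS /exists_inP[v vS uv]]; apply: contra uv.
move/forall_inP=> /(_ u (in_setT u)) /forall_inP/(_ v (in_setT v)) /implyP H.
have [->|/H euv] := eqVneq u v; first exact: connect0.
by apply: connect1; rewrite /induced /= uS vS.
Qed.

Lemma vertex_connectivity_le A : vertex_cut e [set: T] A ->
  vertex_connectivity e [set: T] <= #|A|.
Proof.
move=> HA; rewrite /vertex_connectivity (negPf (vertex_cut_nonclique HA)).
have := mem_index_enum A; elim: (index_enum _) => //= B r IH.
rewrite inE big_cons => /orP[/eqP<-|/IH le]; first by rewrite HA geq_minl.
by case: ifP => // _; apply: leq_trans le; apply: geq_minr.
Qed.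

(** The cut [A] excludes the clique case of the definition, and [k <= #|T|] takes care of the
    default value of the minimum. *)
Lemma vertex_connectivity_ge A k : vertex_cut e [set: T] A -> k <= #|T| ->
  (forall B, vertex_cut e [set: T] B -> k <= #|B|) ->
  k <= vertex_connectivity e [set: T].
Proof.
move=> HA kT HB; rewrite /vertex_connectivity (negPf (vertex_cut_nonclique HA)).
elim/big_ind: _ => //; first by rewrite cardsT.
by move=> a b ka kb; rewrite leq_min ka.
Qed.

Lemma connected_disconnected : connected e [set: T] -> ~~ disconnected e [set: T].
Proof.
case/andP=> _ /forall_inP H; apply/exists_inP=> -[u uS /exists_inP[v vS]].
by move/forall_inP: (H u uS) => /(_ v vS) ->.
Qed.

Lemma articulation_not_2connected x : articulation_point e [set: T] x ->
  ~~ k_connected e 2 [set: T].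
Proof.
case/andP=> _ Hx; rewrite -ltnNge ltnS -(cards1 x); apply: vertex_connectivity_le.
by rewrite /vertex_cut subsetT.
Qed.

Lemma minimum_cut2 x y : connected e [set: T] ->
  (forall z, ~~ articulation_point e [set: T] z) -> x != y ->
  vertex_cut e [set: T] [set x; y] ->
  k_connected e 2 [set: T] /\ minimum_vertex_cut e [set: T] [set x; y].
Proof.
move=> HG Ha xy Hc; have H2 : #|[set x; y]| = 2 by rewrite cards2 xy.
have Hk : 2 <= vertex_connectivity e [set: T].
  apply: (vertex_connectivity_ge Hc); first by rewrite -H2 max_card.
  move=> B HB; rewrite ltnNge; apply/negP=> B1.
  case/andP: HB => _; have: #|B| = 0 \/ #|B| == 1 by case: #|B| B1 => [|[|]]; [left|right|].
  case=> [/eqP|/cards1P[z ->]].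
    by rewrite cards_eq0 => /eqP->; rewrite setD0 (negPf (connected_disconnected HG)).
  by move: (Ha z); rewrite /articulation_point inE /= => /negPf->.
split; first exact: Hk.
by rewrite /minimum_vertex_cut Hc H2 eqn_leq Hk -{1}H2 vertex_connectivity_le.
Qed.

End Connectivity.

(** * Covering a 3K1-free component by a path from the articulation point *)

Section PendantComponent.

Variables (T : finType) (e : rel T).
Hypotheses (e_sym : symmetric e) (e_irr : irreflexive e).
Implicit Types (x y z u v w : T) (p q s t : seq T) (A S X : {set T}).

(** The path must start at [x], so its first vertex cannot serve in an independent set. The
    successors of the attachments lie in [Q], however, and together with a vertex of [H] two of them
    would already contradict 3K1-freeness: [H] has a single attachment on the path. *)
Lemma pendant_walk x y0 (Q : {set T}) :
  x \notin Q -> {in Q, forall y z, z \notin Q -> e y z -> z = x} ->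
  ~~ disconnected e Q -> kK1_free e 3 Q -> y0 \in Q -> e x y0 ->
  (exists s, [/\ path e x s, uniq s & s =i Q]) \/
  (exists a C, [/\ articulation_point e [set: T] a,
     C \in components e ([set: T] :\ a) & clique e C]).
Proof.
move=> xQ Qout Qconn Qfree y0Q xy0.
pose P s := [&& path e x s, uniq s & all (mem Q) s].
have P0 : P [::] by [].
have [|s /and3P[Hs Us /allP sQ] max] := longest_uniq P0; first by move=> ? /and3P[].
have [|/forall_inPn[h hQ hs]] := boolP [forall z in Q, z \in s].
  move=> /forall_inP Qs; left; exists s; split=> // z.
  by apply/idP/idP => [/sQ|/Qs].
right; pose D := [set y in Q | y \notin s]; pose H := component e D h.
have hD : h \in D by rewrite inE hQ.
have hH : h \in H by apply: component_refl.
have HD z : z \in H -> (z \in Q) && (z \notin s).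
  by rewrite inE => /andP[]; rewrite inE.
have HQ z : z \in H -> z \in Q by case/HD/andP.
have Hns z : z \in H -> z \notin s by case/HD/andP.
have Hout z w : z \in H -> e z w -> w \notin H -> w \in x :: s.
  move=> zH zw; apply: contraR; rewrite inE negb_or => /andP[wx ws].
  have [wQ|wQ] := boolP (w \in Q); last by rewrite (Qout z (HQ _ zH) w) ?eqxx in wx.
  by apply: component_adj zw; rewrite // inE wQ.
have Hxs z : z \in H -> z \notin x :: s.
  by move=> zH; rewrite inE negb_or Hns // andbT; apply: contraNneq xQ => <-; apply: HQ.
have Uxs : uniq (x :: s) by rewrite /= Us andbT; apply: contra xQ => /sQ.
have longer q v L : walk e x v L -> perm_eq L (q ++ x :: s) -> uniq q ->
    {subset q <= H} -> q != [::] -> False.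
  move=> HL pL Uq qH q0; case: L HL pL => // x' L HL pL; have Ex := walk_headE HL; subst x'.
  have pL' : perm_eq L (q ++ s).
    by rewrite -(perm_cons x); apply: perm_trans pL _; rewrite perm_catC /= perm_cons perm_catC.
  have := perm_size pL'; rewrite size_cat => Es.
  have: size L <= size s.
    2: by rewrite Es -[X in _ <= X]add0n leq_add2r leqn0 size_eq0 (negPf q0).
  apply: max; apply/and3P; split; first by case/and3P: HL.
    rewrite (perm_uniq pL') cat_uniq Uq Us andbT /=.
    by apply/hasPn=> z zs; apply: contraL zs => /qH/Hns.
  by apply/allP=> z; rewrite (perm_mem pL') mem_cat => /orP[/qH/HQ|/sQ].
have wxs : walk e x (last x s) (x :: s) by apply: sorted_walk.
have Hlast z : z \in H -> ~~ e (last x s) z.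
  move=> zH; apply/negP=> ez.
  apply: (longer [:: z] z ((x :: s) ++ [:: z])) => //; first by wlk.
    by perm_count.
  by move=> ?; rewrite inE => /eqP->.
have Hwalk z z' : z \in H -> z' \in H ->
    exists q, [/\ walk e z z' q, uniq q, {subset q <= H} & q != [::]].
  move=> zH z'H; have [q [wq Uq qH]] := component_walk e_sym zH z'H.
  by exists q; split=> //; case: (q) wq.
(* Given attachments [c] before [d] with successors [cp] and [dp], the vertices [zc], [cp], [dp] are
   shown to be independent in [Q]. *)
have claim p1 c r d zc zd : x :: s = p1 ++ c :: r -> d \in r -> zc \in H -> zd \in H ->
    e zc c -> e zd d -> False.
  move=> Ex dr zcH zdH ec ed.
  case/splitPr: dr Ex => p2 p3 Ex.
  have Ex2 : x :: s = (p1 ++ [:: c]) ++ (p2 ++ ([:: d] ++ p3)) by rewrite Ex -catA.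
  have p3N : p3 != [::].
    apply: contraTneq ed => E3; rewrite e_sym.
    have -> : d = last x s by rewrite -[last x s]/(last x (x :: s)) Ex2 E3 !last_cat.
    exact: Hlast.
  have w0 := wxs; rewrite Ex2 in w0.
  have n1 : p1 ++ [:: c] != [::] by case: (p1).
  have n2 : p2 ++ ([:: d] ++ p3) != [::] by case: (p2).
  have [c' [cp [w1 e1 w2]]] := walk_catE w0 n1 n2.
  have Ec := walk_lastE w1; subst c'.
  have [q [wq Uq qH qN]] := Hwalk _ _ zcH zdH.
  (* If [c] and [d] were consecutive, [q] would fit between them. *)
  have p2N : p2 != [::].
    apply/eqP=> E2; rewrite E2 /= in Ex2 w2; have Ecp := walk_headE w2; subst cp.
    apply: (longer q (last x s) ((p1 ++ [:: c]) ++ (q ++ ([:: d] ++ p3)))) => //; first by wlk.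
    by rewrite Ex2; perm_count.
  have [//|dm [d' [w3 e2 w4]]] := walk_catE w2 p2N.
  have [//|d'' [dp [w5 e3 w6]]] := walk_catE w4 _ p3N.
  have Ed := walk_lastE (s := [::]) w5; subst d''; have {}Ed := walk_headE w4; subst d'.
  have qrH : {subset rev q <= H} by move=> z; rewrite mem_rev; apply: qH.
  have cpx : cp \in x :: s by rewrite Ex2 !mem_cat (walk_head w3) ?orbT.
  have dpx : dp \in x :: s by rewrite Ex2 !mem_cat (walk_head w6) ?orbT.
  have neH z w : z \in H -> w \in x :: s -> z != w.
    by move=> zH; apply: contraTneq => <-; apply: Hxs.
  have N1 : nadj e zc cp.
    rewrite /nadj /= neH //; apply/negP=> ez.
    apply: (longer [:: zc] (last x s)
      ((p1 ++ [:: c]) ++ ([:: zc] ++ (p2 ++ ([:: d] ++ p3))))) => //.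
    - by wlk.
    - by rewrite Ex2; perm_count.
    - by move=> ?; rewrite inE => /eqP->.
  have N2 : nadj e zc dp.
    rewrite /nadj /= neH //; apply/negP=> ez.
    apply: (longer (rev q) (last x s) ((p1 ++ [:: c]) ++ (p2 ++ ([:: d] ++ (rev q ++ p3))))) => //.
    - by wlk.
    - by rewrite Ex2; perm_count.
    - by rewrite rev_uniq.
    - by rewrite -size_eq0 size_rev size_eq0.
  have Uxs2 := Uxs; rewrite Ex2 in Uxs2.
  have N3 : nadj e cp dp.
    apply/andP; split.
      apply: contraTneq Uxs2 => Ecd; apply/negP; rewrite !cat_uniq.
      case/and5P=> _ _ _ /hasPn/(_ dp); rewrite !mem_cat (walk_head w6) orbT => /(_ isT).
      by rewrite -Ecd (walk_head w3).
    apply/negP=> ez.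
    by apply: (longer q (last x s) ((p1 ++ [:: c]) ++ (q ++ ([:: d] ++ (rev p2 ++ p3)))));
      [wlk | rewrite Ex2; perm_count | | | ].
  have inQ z : z \in p2 ++ ([:: d] ++ p3) -> z \in Q.
    case: (p1) Ex2 => [|a p1'] [_ Es] zp; apply: sQ; rewrite Es // mem_cat zp orbT //.
  have := free_nadj e_sym Qfree (s := [:: zc; cp; dp]) _ erefl.
  rewrite /= N1 N2 N3 /= => /(_ _)/negP; apply=> // z; rewrite !inE.
  case/or3P=> /eqP->; [exact: HQ | apply: inQ | apply: inQ].
    by rewrite mem_cat (walk_head w3).
  by rewrite !mem_cat (walk_head w6) !orbT.
have s0 : s != [::].
  by apply/eqP=> E; move: (max [:: y0]); rewrite E /P /= xy0 y0Q => /(_ isT).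
have ys : head x s \in s by case: (s) s0 => //= ? ? _; rewrite mem_head.
have inH w : w \in x :: s -> w \notin H by move=> ws; apply: contraL ws => /Hxs.
have yH : head x s \notin H by apply: inH; rewrite inE ys orbT.
(* Connectivity of [Q] itself provides an attachment in [Q], hence different from [x]. *)
have [z [a [zH aQ aH za]]] := edge_out Qconn hH hQ (sQ _ ys) yH.
have axs : a \in x :: s by apply: Hout za aH.
have xa : x != a by apply: contraNneq xQ => ->.
have unique z' w : z' \in H -> e z' w -> w \notin H -> w = a.
  move=> z'H zw wH; apply/eqP; apply/negPn/negP=> wa.
  have wxs' : w \in x :: s by apply: Hout zw wH.
  have [p1 [r Ex]] : exists p1 r, x :: s = p1 ++ a :: r.
    by case/splitPr: axs => p1 r; exists p1, r.
  have := wxs'; rewrite Ex mem_cat inE (negPf wa) /= => /orP[wp|wr]; last first.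
    exact: claim Ex wr zH z'H za zw.
  case/splitPr: wp Ex => p3 p4; rewrite -catA => Ex.
  by apply: claim Ex _ z'H zH zw za; rewrite mem_cat mem_head orbT.
have al : a != last x s.
  by apply: contraTneq za => ->; rewrite e_sym; apply: Hlast.
have [ap [s1 [t1 [Ex w1 e1 w2]]]] := walk_splitr wxs axs al.
have apt := walk_head w2.
have apxs : ap \in x :: s by rewrite Ex mem_cat apt orbT.
have apQ : ap \in Q.
  move: apxs; rewrite inE => /orP[/eqP Eap|]; last exact: sQ.
  move: Uxs; rewrite Ex cat_uniq => /and3P[_ /hasPn/(_ _ apt)].
  by case/negP; rewrite Eap; apply: walk_head w1.
have apN z' : z' \in H -> nadj e z' ap.
  move=> z'H; apply/andP; split; first by apply: contraTneq z'H => ->; apply: inH.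
  apply/negP=> /(unique _ _ z'H) Eap.
  by move: e1; rewrite Eap ?e_irr //; apply: inH.
(* The successor [ap] of [a] would complete two non-adjacent vertices of [H] to an independent
   triple of [Q]. *)
have Hclique : {in H &, forall z1 z2, z1 != z2 -> e z1 z2}.
  move=> z1 z2 z1H z2H z12; apply/negPn/negP=> Ne.
  have := free_nadj e_sym Qfree (s := [:: z1; z2; ap]) _ erefl.
  rewrite /= !apN // {1}/nadj /= z12 Ne /= => /(_ _)/negP; apply=> // z'; rewrite !inE.
  by case/or3P=> /eqP-> //; apply: HQ.
exists a, (component e ([set: T] :\ a) h).
have closed : {in H & [set: T] :\ a, forall z1 z2, e z1 z2 -> z2 \in H}.
  move=> z1 z2 z1H z2a e12; apply/negPn/negP=> /(unique _ _ z1H e12) E2.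
  by move: z2a; rewrite E2 !inE eqxx.
have neq_a z1 : z1 \in H -> z1 \in [set: T] :\ a.
  by move=> z1H; rewrite !inE andbT; apply: contraNneq aH => <-.
split.
- rewrite /articulation_point inE; apply: (closed_disconnected closed hH (y := x)).
  + exact: neq_a.
  + by rewrite !inE xa.
  + by apply: inH; rewrite mem_head.
- by apply/componentsP; exists h => //; apply: neq_a.
- have /subsetP sub := component_closed closed hH.
  apply/forall_inP=> z1 /sub z1H; apply/forall_inP=> z2 /sub z2H.
  by apply/implyP; apply: Hclique.
Qed.

(** An independent set of [Q1] and one of [Q2] form an independent set together. *)
Lemma free_split k l (Q1 Q2 B : {set T}) : kK1_free e (k + l) [set: T] ->
  {in Q1 & Q2, forall x y, nadj e x y} ->
  B \subset Q2 -> #|B| = l -> independent e B -> kK1_free e k Q1.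
Proof.
move=> HG HQ /subsetP BQ Bl iB; apply: contra HG => /existsP[A /and3P[/subsetP AQ /eqP Ak iA]].
apply/existsP; exists (A :|: B); rewrite subsetT.
have N x y : x \in A -> y \in B -> nadj e x y by move=> /AQ xA /BQ yB; apply: HQ.
rewrite cardsU disjoint_setI0 ?cards0 ?subn0 ?Ak ?Bl ?eqxx //=; last first.
  apply/pred0P=> x /=; apply/negP=> /andP[xA xB].
  by have := N x x xA xB; rewrite /nadj /= eqxx.
apply/forall_inP=> x xAB; apply/forall_inP=> y yAB; apply/implyP=> xy.
move: xAB yAB; rewrite !inE => /orP[xA|xB] /orP[yA|yB].
- by move/forall_inP/(_ x xA)/forall_inP/(_ y yA)/implyP: iA; apply.
- by case/andP: (N _ _ xA yB).
- by rewrite e_sym; case/andP: (N _ _ yA xB).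
- by move/forall_inP/(_ x xB)/forall_inP/(_ y yB)/implyP: iB; apply.
Qed.

End PendantComponent.

(** * Sufficiency when there is an articulation point *)

Section OneConnected.

Variables (T : finType) (e : rel T).
Hypotheses (e_sym : symmetric e) (e_irr : irreflexive e).
Implicit Types (a x y z u v w : T) (p q s t : seq T) (A S X C Q : {set T}).

Lemma components_nadj S C C' : C \in components e S -> C' \in components e S ->
  C != C' -> {in C & C', forall x y, nadj e x y}.
Proof.
case/componentsP=> w wS -> /componentsP[w' w'S ->] ne x y xC yC.
have [//|/nadjPn[E|xy]] := boolP (nadj e x y); case/negP: ne.
  by rewrite -(component_eq e_sym xC) E (component_eq e_sym yC).
have yS : y \in S by move: yC; rewrite inE => /andP[].
by rewrite -(component_eq e_sym (component_adj xC yS xy)) (component_eq e_sym yC).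
Qed.

Lemma components_connected S C : C \in components e S -> ~~ disconnected e C.
Proof.
case/componentsP=> w wS ->; apply: (comp_connected e_sym (x := w)).
have wC := component_refl e wS.
apply/subsetP=> z zC; have [q [wq _ qC]] := component_walk e_sym wC zC.
by have H := walk_connect e_sym wq qC; apply: H (walk_last wq).
Qed.

Lemma components_exit a C : C \in components e ([set: T] :\ a) ->
  {in C, forall y z, z \notin C -> e y z -> z = a}.
Proof.
case/componentsP=> w wS -> y yC z zC yz; apply/eqP; apply: contraNT zC => za.
by apply: component_adj yz; rewrite // !inE za.
Qed.

Lemma components_attach a C : connected e [set: T] -> C \in components e ([set: T] :\ a) ->
  exists2 y, y \in C & e y a.
Proof.
move=> HG HC; have Hex := components_exit HC; case/componentsP: HC => w wS EC.
have wC : w \in C by rewrite EC component_refl.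
have aC : a \notin C by rewrite EC !inE eqxx.
have [z [y [zC _ yC zy]]] := edge_out (connected_disconnected HG) wC (in_setT w) (in_setT a) aC.
by exists z => //; rewrite -(Hex z zC y yC zy).
Qed.

Lemma articulation_components a C : articulation_point e [set: T] a ->
  #|components e ([set: T] :\ a)| <= 2 -> C \in components e ([set: T] :\ a) ->
  exists C', [/\ C != C', C' \in components e ([set: T] :\ a) &
    components e ([set: T] :\ a) = [set C; C']].
Proof.
case/andP=> _ /exists_inP[u uS /exists_inP[v vS uv]] H2 HC.
set S := [set: T] :\ a in uS vS uv H2 HC *.
have [C' HC' ne] : exists2 C', C' \in components e S & C != C'.
  have Hu : component e S u \in components e S by apply/componentsP; exists u.
  have Hv : component e S v \in components e S by apply/componentsP; exists v.
  have [Eu|] := eqVneq C (component e S u); last by exists (component e S u).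
  exists (component e S v) => //; apply: contra uv => /eqP Ev.
  have := component_refl e vS; rewrite -Ev Eu inE => /andP[_] //.
exists C'; split=> //; apply/esym/eqP; rewrite eqEcard cards2 ne H2 andbT.
by apply/subsetP=> D; rewrite !inE => /orP[]/eqP->.
Qed.

Hypotheses (G_conn : connected e [set: T]) (G_free : kK1_free e 5 [set: T]).
Hypothesis two_components :
  forall x : T, articulation_point e [set: T] x -> #|components e ([set: T] :\ x)| <= 2.
Hypothesis pendant_clique :
  forall (x : T) (Q1 Q2 : {set T}), articulation_point e [set: T] x ->
    Q1 != Q2 -> components e ([set: T] :\ x) = [set Q1; Q2] ->
    clique e Q1 -> kK1_free e 4 Q2 ->
    exists u : T, [/\ u \in Q2, e x u & has_ham_path_from e Q2 u].

Lemma join_ham_paths a C C' p q : C != C' ->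
  components e ([set: T] :\ a) = [set C; C'] ->
  path e a p -> path e a q -> uniq p -> uniq q -> p =i C -> q =i C' ->
  has_ham_path e [set: T].
Proof.
move=> ne EC Hp Hq Up Uq pC qC; exists (rev p ++ a :: q).
have HC : C \in components e ([set: T] :\ a) by rewrite EC !inE eqxx.
have HC' : C' \in components e ([set: T] :\ a) by rewrite EC !inE eqxx orbT.
have aC D : D \in components e ([set: T] :\ a) -> a \notin D.
  by case/componentsP=> w _ ->; rewrite !inE eqxx.
split.
- have := sorted_walk (Hp : sorted e (a :: p)); move/(walk_rev e_sym)/walk_sorted; rewrite rev_cons.
  case/lastP: p {Hp Up pC} => [|p b]; first by [].
  rewrite rev_rcons /= rcons_path => /andP[H1 H2].
  by rewrite cat_path /= H1 H2.
- rewrite cat_uniq rev_uniq Up /= Uq qC aC // andbT negb_or mem_rev pC aC //=.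
  rewrite andbT.
  apply/hasPn=> z; rewrite mem_rev pC qC => zC'; apply/negP=> zC.
  by have := components_nadj HC HC' ne zC zC'; rewrite /nadj /= eqxx.
- move=> z; rewrite !inE mem_cat mem_rev inE pC qC.
  have [->|za] := eqVneq z a; first by rewrite orbT.
  have zS : z \in [set: T] :\ a by rewrite !inE za.
  have : component e ([set: T] :\ a) z \in [set C; C'].
    by rewrite -EC; apply/componentsP; exists z.
  by rewrite !inE => /orP[]/eqP <-; rewrite component_refl ?orbT.
Qed.

(** A vertex of [C] extends every independent set of [C'], so [C'] is 4K1-free and (c) gives a path
    of [C'] from a neighbour of [a]. The clique [C] can be traversed from any of its vertices
    adjacent to [a]. *)
Lemma clique_component_ham a C : articulation_point e [set: T] a ->
  C \in components e ([set: T] :\ a) -> clique e C -> has_ham_path e [set: T].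
Proof.
move=> Ha HC KC; have [C' [ne HC' EC]] := articulation_components Ha (two_components Ha) HC.
have [y yC ya] := components_attach G_conn HC.
have F4 : kK1_free e 4 C'.
  apply: (@free_split _ _ e_sym 4 1 _ C [set y]); rewrite ?cards1 ?sub1set //.
    by move=> z w zC wC; apply: components_nadj HC' HC _ _ _ _ _; rewrite // eq_sym.
  apply/forall_inP=> z; rewrite inE => /eqP->; apply/forall_inP=> w.
  by rewrite inE => /eqP->; rewrite eqxx.
have [u [uC' au [q [Hq Uq qC']]]] := pendant_clique Ha ne EC KC F4.
have [|| v [p [_ wp pC]]] := @clique_walk_from _ e (enum C) y (enum_uniq _).
- move=> z w; rewrite !mem_enum => zC wC; move/forall_inP: KC => /(_ z zC).
  by move/forall_inP/(_ w wC)/implyP.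
- by rewrite mem_enum.
apply: (@join_ham_paths a C C' p (u :: q)) => //.
- case: p wp {pC} => // x p wp; have Ex := walk_headE wp; subst x.
  by rewrite /= e_sym ya; apply: walk_sorted wp.
- by rewrite /= au.
- by rewrite (perm_uniq pC) enum_uniq.
- by move=> z; rewrite (perm_mem pC) mem_enum.
Qed.

Lemma articulation_ham a : articulation_point e [set: T] a -> has_ham_path e [set: T].
Proof.
move=> Ha; have /andP[_ /exists_inP[u uS _]] := Ha.
have HC : component e ([set: T] :\ a) u \in components e ([set: T] :\ a).
  by apply/componentsP; exists u.
have [C' [ne HC' EC]] := articulation_components Ha (two_components Ha) HC.
set C := component e ([set: T] :\ a) u in HC ne EC.
have aC D : D \in components e ([set: T] :\ a) -> a \notin D.
  by case/componentsP=> w _ ->; rewrite !inE eqxx.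
have [|KC] := boolP (clique e C); first exact: clique_component_ham Ha HC.
have [|KC'] := boolP (clique e C'); first exact: clique_component_ham Ha HC'.
(* Two non-adjacent vertices of [D'] leave room for at most two independent vertices in [D]. *)
have F3 D D' : D \in components e ([set: T] :\ a) -> D' \in components e ([set: T] :\ a) ->
    D != D' -> ~~ clique e D' -> kK1_free e 3 D.
  move=> HD HD' DD' /forall_inPn[x xD /forall_inPn[y yD]]; rewrite negb_imply => /andP[xy Nxy].
  apply: (@free_split _ _ e_sym 3 2 D D' [set x; y]) => //.
  - exact: components_nadj HD HD' DD'.
  - by apply/subsetP=> z; rewrite !inE => /orP[]/eqP->.
  - by rewrite cards2 xy.
  - by apply/forall_inP=> z; rewrite !inE => /orP[]/eqP->; apply/forall_inP=> w;
      rewrite !inE => /orP[]/eqP->; rewrite ?eqxx ?Nxy ?implybT //= e_sym Nxy implybT.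
have pendant D : D \in components e ([set: T] :\ a) -> kK1_free e 3 D ->
    has_ham_path e [set: T] \/ exists s, [/\ path e a s, uniq s & s =i D].
  move=> HD FD; have [y yD ya] := components_attach G_conn HD.
  have ay : e a y by rewrite e_sym.
  have := pendant_walk e_sym e_irr (aC D HD) (components_exit HD)
    (components_connected HD) FD yD ay.
  by case=> [|[b [K [Hb HK KK]]]]; [right | left; apply: clique_component_ham Hb HK KK].
have [//|[p [Hp Up pC]]] := pendant C HC (F3 _ _ HC HC' ne KC').
rewrite eq_sym in ne; have [//|[q [Hq Uq qC]]] := pendant C' HC' (F3 _ _ HC' HC ne KC).
by rewrite eq_sym in ne; apply: join_ham_paths ne EC Hp Hq Up Uq pC qC.
Qed.

End OneConnected.

(** * Longest paths with two attachments of a missed component *)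

Section TwoAttachments.

Variables (T : finType) (e : rel T).
Hypotheses (e_sym : symmetric e) (e_irr : irreflexive e).
Hypothesis G_free : kK1_free e 5 [set: T].
Implicit Types (a b x y z u v w h : T) (p q s t : seq T) (X : {set T}).

Lemma free5 x1 x2 x3 x4 x5 : ~~ pairwise (nadj e) [:: x1; x2; x3; x4; x5].
Proof. by apply: (free_nadj e_sym G_free) => // x _; apply: in_setT. Qed.

(** The vertices that a rerouting adds to the longest path. *)
Definition fresh q p := [&& q != [::], uniq q & all (fun z => z \notin p) q].

Lemma fresh1 z p : fresh [:: z] p = (z \notin p).
Proof. by rewrite /fresh /= andbT. Qed.

Lemma fresh_rev q p : fresh (rev q) p = fresh q p.
Proof. by rewrite /fresh rev_uniq all_rev -size_eq0 size_rev size_eq0. Qed.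

Lemma perm_fresh q p p' : perm_eq p p' -> fresh q p = fresh q p'.
Proof.
by move=> pp; congr [&& _, _ & _]; apply: eq_all => z; rewrite (perm_mem pp).
Qed.

Variables (H : {set T}) (n : nat) (h : T).
Hypothesis longest : forall u v p, walk e u v p -> uniq p -> size p <= n.
Hypothesis H_walk : {in H &, forall y z, exists q,
  [/\ walk e y z q, uniq q & {subset q <= H}]}.
Hypothesis hH : h \in H.

Lemma no_longer u v q p L : size p = n -> uniq p -> fresh q p ->
  walk e u v L -> perm_eq L (q ++ p) -> False.
Proof.
move=> pn Up /and3P[q0 Uq /allP qp] wL pL; have := longest wL.
rewrite (perm_size pL) (perm_uniq pL) size_cat pn cat_uniq Uq Up andbT /=.
have -> : ~~ has [in q] p by apply/hasPn=> z zp; apply: contraL zp => /qp.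
by move=> /(_ isT); rewrite -[X in _ <= X]add0n leq_add2r leqn0 size_eq0 (negPf q0).
Qed.

(* The longest path p1 a p2 b p3, both a and b being attached to H; the parts are
   p1 = v1 .. am, p2 = ap .. bm and p3 = bp .. vk, so that m and p stand for
   predecessor and successor. *)
Record config v1 am a ap bm b bp vk p1 p2 p3 : Prop := Config {
  config_walk1 : walk e v1 am p1;
  config_walk2 : walk e ap bm p2;
  config_walk3 : walk e bp vk p3;
  config_edges : [/\ e am a, e a ap, e bm b & e b bp];
  config_uniq : uniq (p1 ++ ([:: a] ++ (p2 ++ ([:: b] ++ p3))));
  config_size : size (p1 ++ ([:: a] ++ (p2 ++ ([:: b] ++ p3)))) = n;
  config_out : {in H, forall z, z \notin p1 ++ ([:: a] ++ (p2 ++ ([:: b] ++ p3)))};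
  config_detour : exists ha hb q, [/\ walk e ha hb q,
    fresh q (p1 ++ ([:: a] ++ (p2 ++ ([:: b] ++ p3)))), {subset q <= H}, e a ha & e hb b] }.

(* Rotating a configuration gives another one, with the roles of a and b possibly
   exchanged. *)
Lemma config_perm v1 am a ap bm b bp vk p1 p2 p3 w1 bm' a' bp' am' b' ap' wk q1 q2 q3 :
  config v1 am a ap bm b bp vk p1 p2 p3 ->
  walk e w1 bm' q1 -> walk e bp' am' q2 -> walk e ap' wk q3 ->
  [/\ e bm' a', e a' bp', e am' b' & e b' ap'] -> (a', b') = (a, b) \/ (a', b') = (b, a) ->
  perm_eq (q1 ++ ([:: a'] ++ (q2 ++ ([:: b'] ++ q3))))
    (p1 ++ ([:: a] ++ (p2 ++ ([:: b] ++ p3)))) ->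
  config w1 bm' a' bp' am' b' ap' wk q1 q2 q3.
Proof.
case=> _ _ _ _ U Sz out [ha [hb [q [wq Fq qH ea eb]]]] wq1 wq2 wq3 es ab pP.
split=> //; rewrite ?(perm_uniq pP) ?(perm_size pP) //.
  by move=> z zH; rewrite (perm_mem pP) out.
case: ab => -[Ea Eb]; subst a' b'; first by exists ha, hb, q; rewrite (perm_fresh _ pP).
exists hb, ha, (rev q); rewrite (perm_fresh _ pP) fresh_rev; split=> //.
- exact: walk_rev.
- by move=> z; rewrite mem_rev; apply: qH.
- by rewrite e_sym.
- by rewrite e_sym.
Qed.

(** Predecessors become successors and [p1] changes places with [p3], so every fact about
    configurations has a mirror image. *)
Lemma config_rev v1 am a ap bm b bp vk p1 p2 p3 :
  config v1 am a ap bm b bp vk p1 p2 p3 ->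
  config vk bp b bm ap a am v1 (rev p3) (rev p2) (rev p1).
Proof.
move=> C; have [w1 w2 w3 [e1 e2 e3 e4] _ _ _ _] := C.
apply: (config_perm C); [by wlk | by wlk | by wlk | | by right | perm_count].
by split; rewrite e_sym.
Qed.

Section Config.

Variables (v1 am a ap bm b bp vk : T) (p1 p2 p3 : seq T).
Hypothesis C : config v1 am a ap bm b bp vk p1 p2 p3.

Lemma config_neq : [/\ {in p1 & p2, forall x y, x != y}, {in p1 & p3, forall x y, x != y}
  & {in p2 & p3, forall x y, x != y}].
Proof.
have ne s t : uniq (s ++ t) -> {in s & t, forall x y, x != y}.
  rewrite cat_uniq => /and3P[_ /hasPn st _] x y xs yt; apply: contraTneq xs => ->.
  exact: st.
have [_ _ _ _ U _ _ _] := C; have N1 := ne _ _ U.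
move: U; rewrite cat_uniq => /and3P[_ _]; rewrite cat_uniq => /and3P[_ _ /ne N2].
split=> x y xp yp.
- by apply: N1; rewrite // !mem_cat yp orbT.
- by apply: N1; rewrite // !mem_cat yp !orbT.
- by apply: N2; rewrite // !mem_cat yp !orbT.
Qed.

Lemma config_notin : [/\ a != b, a \notin p1, a \notin p2, a \notin p3 &
  [/\ b \notin p1, b \notin p2 & b \notin p3]].
Proof.
have [_ _ _ _ U _ _ _] := C.
have: uniq (a :: b :: (p1 ++ (p2 ++ p3))).
  rewrite -(perm_uniq (s1 := p1 ++ ([:: a] ++ (p2 ++ ([:: b] ++ p3))))) //.
  by perm_count.
rewrite !cons_uniq in_cons !mem_cat !negb_or => /andP[/andP[-> /andP[-> /andP[-> ->]]]].
by case/andP=> /andP[-> /andP[-> ->]].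
Qed.

Ltac longer_path NL L := apply: (NL _ _ L); [wlk | perm_count].

(** Any of these edges would allow one path through the whole of [P] and the detour. With [v1 vk],
    for instance, [P] closes into a cycle, which is cut open before [a] and prolonged there by the
    detour. *)
Lemma config_nadj : [/\ nadj e v1 vk, nadj e v1 ap, nadj e v1 bp, nadj e ap bp & nadj e v1 bm].
Proof.
have [w1 w2 w3 [e1 e2 e3 e4] U Sz _ [ha [hb [q [wq Fq _ ea eb]]]]] := C.
have [N12 N13 N23] := config_neq.
have m1 := walk_head w1; have m2 := walk_head w2; have m2' := walk_last w2.
have m3 := walk_head w3; have m3' := walk_last w3.
have NL u v L := @no_longer u v q _ L Sz U Fq.
split; (apply/andP; split; first by [apply: N12 | apply: N13 | apply: N23]); apply/negP=> E.
- longer_path NL (rev q ++ ([:: a] ++ (p2 ++ ([:: b] ++ (p3 ++ p1))))).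
- longer_path NL (rev q ++ ([:: a] ++ (rev p1 ++ (p2 ++ ([:: b] ++ p3))))).
- longer_path NL (p2 ++ ([:: b] ++ (rev q ++ ([:: a] ++ (rev p1 ++ p3))))).
- longer_path NL (p1 ++ ([:: a] ++ (q ++ ([:: b] ++ (rev p2 ++ p3))))).
- longer_path NL (rev p3 ++ ([:: b] ++ (rev q ++ ([:: a] ++ (p2 ++ p1))))).
Qed.

(** The vertex [z] need not lie on the detour; it is reached inside [H] from [ha] or [hb], and that
    walk would fit right after [a] or [b]. *)
Lemma config_nadj_out z : z \in H -> [/\ nadj e z v1, nadj e z ap & nadj e z bp].
Proof.
have [w1 w2 w3 [e1 e2 e3 e4] U Sz out [ha [hb [q [wq Fq qH ea eb]]]]] := C.
move=> zH; have zP := out z zH.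
have Fz : fresh [:: z] (p1 ++ ([:: a] ++ (p2 ++ ([:: b] ++ p3)))) by rewrite fresh1.
have NLz u v L := @no_longer u v _ _ L Sz U Fz.
have NLq r u v L : uniq r -> {subset r <= H} -> r != [::] -> 
   walk e u v L -> perm_eq L (r ++ (p1 ++ ([:: a] ++ (p2 ++ ([:: b] ++ p3))))) -> False.
  move=> Ur rH r0; apply: no_longer => //; rewrite /fresh r0 Ur.
  by apply/allP=> y /rH; apply: out.
have haH : ha \in H by apply/qH/(walk_head wq).
have hbH : hb \in H by apply/qH/(walk_last wq).
have [r [wr Ur rH]] := H_walk haH zH; have [r' [wr' Ur' rH']] := H_walk hbH zH.
have r0 : r != [::] by case: (r) wr.
have r0' : r' != [::] by case: (r') wr'.
have NLr u v L := NLq r u v L Ur rH r0; have NLr' u v L := NLq r' u v L Ur' rH' r0'.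
have neq y : y \in p1 ++ p2 ++ p3 -> z != y.
  move=> yP; apply: contraNneq zP => ->; move: yP; rewrite !mem_cat => /or3P[]->; by rewrite ?orbT.
split; (apply/andP; split; first by
  apply: neq; rewrite !mem_cat ?(walk_head w1) ?(walk_head w2) ?(walk_head w3) ?orbT);
  apply/negP=> E.
- longer_path NLz ([:: z] ++ (p1 ++ ([:: a] ++ (p2 ++ ([:: b] ++ p3))))).
- longer_path NLr (p1 ++ ([:: a] ++ (r ++ (p2 ++ ([:: b] ++ p3))))).
- longer_path NLr' (p1 ++ ([:: a] ++ (p2 ++ ([:: b] ++ (r' ++ p3))))).
Qed.

End Config.
Definition attached c := [exists z in H, e z c].

(** The three parts are non-empty: an attached end of the path would prolong it, and a detour would
    fit between consecutive attachments. *)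
Lemma config_build u v a b p1 p2 p3 (p := p1 ++ ([:: a] ++ (p2 ++ ([:: b] ++ p3)))) :
  walk e u v p -> uniq p -> size p = n -> {in H, forall z, z \notin p} ->
  attached a -> attached b ->
  exists am ap bm bp, config u am a ap bm b bp v p1 p2 p3.
Proof.
move=> wp Up Sp out /exists_inP[za zaH ea] /exists_inP[zb zbH eb].
have [q [wq Uq qH]] := H_walk zaH zbH.
have Fq : fresh q p.
  rewrite /fresh Uq; have -> : q != [::] by case: (q) wq.
  by apply/allP=> z /qH; apply: out.
have F1 z : z \in H -> fresh [:: z] p by rewrite fresh1; apply: out.
have p10 : p1 != [::].
  apply/eqP=> E; have wa := wp; rewrite /p E in wa; have Ea := walk_headE wa.
  apply: (no_longer Sp Up (F1 za zaH) (u := za) (v := v) (L := [:: za] ++ p)); last by perm_count.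
  by apply: walk_cat wp; [apply: walk1 | rewrite -Ea].
have p30 : p3 != [::].
  apply/eqP=> E; have wb := wp; rewrite /p E cats0 !catA in wb; have Eb := walk_lastE wb.
  apply: (no_longer Sp Up (F1 zb zbH) (u := u) (v := zb) (L := p ++ [:: zb])); last by perm_count.
  by apply: walk_cat wp _ (walk1 _ _); rewrite -Eb e_sym.
have p20 : p2 != [::].
  apply/eqP=> E; have [//|//|y [y' [w1 e1 w2]]] := walk_catE wp.
  have Ey := walk_headE w2; subst y'.
  have [//||y' [y'' [w3 e2 w4]]] := walk_catE w2; first by rewrite E.
  have Ea := walk_lastE (s := [::]) w3; subst y'; rewrite E in w4.
  have Eb := walk_headE w4; subst y''.
  apply: (no_longer Sp Up Fq (L := p1 ++ ([:: a] ++ (q ++ ([:: b] ++ p3))))); first by wlk.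
  by rewrite /p E; perm_count.
have [//|//|am [y' [w1 e1 w2]]] := walk_catE wp; have Ey := walk_headE w2; subst y'.
have [//||y' [ap [w3 e2 w4]]] := walk_catE w2; first by case: (p2) p20.
have Ea := walk_lastE (s := [::]) w3; subst y'.
have [//|//|bm [y' [w5 e3 w6]]] := walk_catE w4; have Ey := walk_headE w6; subst y'.
have [//|//|y' [bp [w7 e4 w8]]] := walk_catE w6.
have Eb := walk_lastE (s := [::]) w7; subst y'.
exists am, ap, bm, bp; split=> //; exists za, zb, q; split=> //.
by rewrite e_sym.
Qed.

(** Each pair of attachments gives a configuration in which the third one is an inner vertex of a
    part. Together they make [h], [u], [ap], [bp], [cp] independent. *)
Lemma no_three_attached u v a b c p1 p2 p3 p4
    (p := p1 ++ ([:: a] ++ (p2 ++ ([:: b] ++ (p3 ++ ([:: c] ++ p4)))))) :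
  walk e u v p -> uniq p -> size p = n -> {in H, forall z, z \notin p} ->
  attached a -> attached b -> attached c -> False.
Proof.
move=> wp Up Sp out aa ab ac.
have [am [ap [bm [bp Cab]]]] := config_build wp Up Sp out aa ab.
have Ep : p = p1 ++ ([:: a] ++ ((p2 ++ ([:: b] ++ p3)) ++ ([:: c] ++ p4))).
  by rewrite /p -!catA.
have Ep' : p = (p1 ++ ([:: a] ++ p2)) ++ ([:: b] ++ (p3 ++ ([:: c] ++ p4))).
  by rewrite /p -!catA.
have [am' [ap' [cm [cp Cac]]]] : exists am ap cm cp,
    config u am a ap cm c cp v p1 (p2 ++ ([:: b] ++ p3)) p4.
  by apply: config_build; rewrite -?Ep.
have [bm' [bp' [cm' [cp' Cbc]]]] : exists bm bp cm cp,
    config u bm b bp cm c cp v (p1 ++ ([:: a] ++ p2)) p3 p4.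
  by apply: config_build; rewrite -?Ep'.
(* The successors obtained from the three configurations are the same vertices. *)
have heads x x' y y' s t : walk e x y s -> walk e x' y' (s ++ t) -> x = x'.
  by case: s => // z s wx wx'; rewrite -(walk_headE wx) (walk_headE wx').
have Eap := heads _ _ _ _ _ _ (config_walk2 Cab) (config_walk2 Cac); subst ap'.
have Ebp := heads _ _ _ _ _ _ (config_walk2 Cbc) (config_walk3 Cab); subst bp'.
have Ecp := heads _ _ _ _ _ [::] (config_walk3 Cac).
rewrite cats0 in Ecp; have {}Ecp := Ecp _ _ (config_walk3 Cbc); subst cp'.
have [_ N1 N2 N3 _] := config_nadj Cab.
have [_ _ N4 N5 _] := config_nadj Cac.
have [_ _ _ N6 _] := config_nadj Cbc.
have [N7 N8 N9] := config_nadj_out Cab hH.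
have [_ _ N10] := config_nadj_out Cac hH.
have /negP := free5 h u ap bp cp; apply; nadjs.
Qed.

Lemma split2 p a b : a \in p -> b \in p -> a != b ->
  exists p1 p2 p3, p = p1 ++ ([:: a] ++ (p2 ++ ([:: b] ++ p3))) \/
    p = p1 ++ ([:: b] ++ (p2 ++ ([:: a] ++ p3))).
Proof.
move=> ap bp ab; case/splitPr: ap bp => p1 r; rewrite mem_cat inE eq_sym (negPf ab) /=.
case/orP=> bp; case/splitPr: bp => s t.
  by exists s, t, r; right; rewrite -catA.
by exists p1, s, t; left.
Qed.

Definition only a b := {in H, forall z w, e z w -> w \notin H -> (w == a) || (w == b)}.

(** Connectivity of [G] gives the first attachment [a], and that of [G - a] a second one. *)
Lemma two_attached u v p : connected e [set: T] ->
  (forall x, ~~ disconnected e ([set: T] :\ x)) ->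
  walk e u v p -> uniq p -> size p = n -> {in H, forall z, z \notin p} ->
  {in H, forall z w, e z w -> w \notin H -> w \in p} ->
  exists am a ap bm b bp p1 p2 p3, config u am a ap bm b bp v p1 p2 p3 /\ only a b.
Proof.
move=> Gc Gx wp Up Sp out att.
have up := walk_head wp.
have uH : u \notin H by apply: contraL up; apply: out.
have Nu : ~~ attached u.
  apply/exists_inP=> -[z zH zu].
  apply: (no_longer Sp Up (q := [:: z]) (u := z) (v := v) (L := [:: z] ++ p)) => //.
    by rewrite fresh1 out.
  by apply: walk_cat wp; first exact: walk1.
have [za [a [zaH _ aH ea]]] := edge_out (connected_disconnected Gc) hH (in_setT h) (in_setT u) uH.
have aa : attached a by apply/exists_inP; exists za.
have ua : u != a by apply: contraNneq Nu => ->.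
have ha : h != a by apply: contraNneq aH => <-.
have [||zb [b [zbH bS bH eb]]] := edge_out (y := u) (Gx a) hH _ _ uH;
  [by rewrite !inE ha | by rewrite !inE ua |].
have ab : attached b by apply/exists_inP; exists zb.
have ne : a != b by move: bS; rewrite !inE andbT eq_sym.
wlog [p1 [p2 [p3 Ep]]] : a b {aH ea ua ha bS bH eb} aa ab ne /
    exists p1 p2 p3, p = p1 ++ ([:: a] ++ (p2 ++ ([:: b] ++ p3))).
  have ap : a \in p by apply: att ea aH.
  have bp : b \in p by apply: att eb bH.
  have [p1 [p2 [p3 [Ep|Ep]]]] := split2 ap bp ne => W.
    by apply: (W a b) => //; exists p1, p2, p3.
  by apply: (W b a) => //; [rewrite eq_sym | exists p1, p2, p3].
subst p.
have [am [ap [bm [bp C]]]] := config_build wp Up Sp out aa ab.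
exists am, a, ap, bm, b, bp, p1, p2, p3; split=> //.
move=> z zH w zw wH; apply/negPn/negP; rewrite negb_or => /andP[wa wb].
have aw : attached w by apply/exists_inP; exists z.
have := att z zH w zw wH; rewrite !mem_cat !inE (negPf wa) (negPf wb) /=.
case/or3P=> wp'; case/splitPr: wp' wp Up Sp out {att up C} => s t wp Up Sp out.
- by apply: (@no_three_attached u v w a b s t p2 p3) => //; move: wp Up Sp out; rewrite -!catA.
- by apply: (@no_three_attached u v a w b p1 s t p3) => //; move: wp Up Sp out; rewrite -!catA.
- by apply: (@no_three_attached u v a b w p1 p2 s t) => //; move: wp Up Sp out; rewrite -!catA.
Qed.

Lemma config_nadjs v1 am a ap bm b bp vk p1 p2 p3 :
  config v1 am a ap bm b bp vk p1 p2 p3 ->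
  [/\ nadj e v1 vk, nadj e v1 ap, nadj e v1 bp, nadj e ap bp & nadj e v1 bm] /\
  [/\ nadj e vk bm, nadj e vk am, nadj e bm am & nadj e vk ap] /\
  [/\ nadj e h v1, nadj e h vk & [/\ nadj e h am, nadj e h ap, nadj e h bm & nadj e h bp]].
Proof.
move=> C; have C' := config_rev C.
have [? ? ?] := config_nadj_out C hH; have [? ? ?] := config_nadj_out C' hH.
by have [] := config_nadj C; have [] := config_nadj C'.
Qed.

(** Otherwise [h], [v1], [vk], [am], [bm] are independent. Applied to a rotated configuration, this
    forces an edge between two vertices known to be non-adjacent. *)
Lemma config_closed1 v1 am a ap bm b bp vk p1 p2 p3 :
  config v1 am a ap bm b bp vk p1 p2 p3 -> v1 = am \/ e v1 am.
Proof.
move=> C; apply: nadjPn; apply/negP=> N.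
have [[? ? ? ? ?] [[? ? ? ?] [? ? [? ? ? ?]]]] := config_nadjs C.
have /negP := free5 h v1 vk am bm; apply; nadjs.
Qed.

Lemma config_closed2 v1 am a ap bm b bp vk p1 p2 p3 :
  config v1 am a ap bm b bp vk p1 p2 p3 -> ap = bm \/ e ap bm.
Proof.
move=> C; apply: nadjPn; apply/negP=> N.
have [[? ? ? ? ?] [[? ? ? ?] [? ? [? ? ? ?]]]] := config_nadjs C.
have /negP := free5 h v1 vk ap bm; apply; nadjs.
Qed.

Lemma nadj_irr x : nadj e x x = false.
Proof. by rewrite /nadj /= eqxx. Qed.

Lemma nadjNe x y : nadj e x y -> e x y = false.
Proof. by case/andP=> _ /negPf. Qed.

Section Rotations.

Variables (v1 am a ap bm b bp vk : T) (p1 p2 p3 : seq T).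
Hypothesis C : config v1 am a ap bm b bp vk p1 p2 p3.

(* If x sees vk, then v1 .. x vk .. bp b bm .. ap a am .. x' is another configuration,
   in which config_closed1 contradicts the non-adjacency of v1 and bp. *)
Lemma nadj_last_first : {in p1, forall x, nadj e vk x}.
Proof.
have [[? ? N1 ? ?] [[? N2 ? ?] _]] := config_nadjs C.
have [w1 w2 w3 [e1 e2 e3 e4] _ _ _ _] := C.
have [_ N13 _] := config_neq C.
move=> x xp; have [->//|xam] := eqVneq x am.
apply/andP; split; first by rewrite eq_sym N13 // (walk_last w3).
apply/negP=> E; have [x' [s [t [Ep ws ex wt]]]] := walk_splitr w1 xp xam.
have C' : config v1 bp b bm ap a am x' (s ++ rev p3) (rev p2) (rev t).
  apply: (config_perm C); [by wlk | by wlk | by wlk | | by right | by rewrite Ep; perm_count].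
  by split; rewrite e_sym.
case: (config_closed1 C') => [E'|E']; first by rewrite E' nadj_irr in N1.
by rewrite (nadjNe N1) in E'.
Qed.

(* If v1 sees y, then y' .. ap a am .. v1 y .. bm b bp .. vk is another configuration,
   in which config_closed2 contradicts the non-adjacency of am and bm. *)
Lemma nadj_first_middle : {in p2, forall y, nadj e v1 y}.
Proof.
have [[? N0 N1 ? ?] [[? ? N2 ?] _]] := config_nadjs C.
have [w1 w2 w3 [e1 e2 e3 e4] _ _ _ _] := C.
have [N12 _ _] := config_neq C.
move=> y yp; have [->//|yap] := eqVneq y ap.
apply/andP; split; first by rewrite N12 // (walk_head w1).
apply/negP=> E; have [y' [s [t [Ep ws ey wt]]]] := walk_splitl e_sym w2 yp yap.
have C' : config y' ap a am bm b bp vk (rev s) (rev p1 ++ t) p3.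
  apply: (config_perm C); [by wlk | by wlk | by wlk | | by left | by rewrite Ep; perm_count].
  by split=> //; rewrite e_sym.
case: (config_closed2 C') => [E'|E']; first by rewrite E' nadj_irr in N2.
by rewrite e_sym (nadjNe N2) in E'.
Qed.

(** Since [v1] sees [am], the part [p1] can be traversed so as to end at [x]. An edge from [x] to
    [bm] would then lead back through [p2] to [a], and by the detour to [b] and [p3]. *)
Lemma nadj_first_bm : {in p1, forall x, nadj e x bm}.
Proof.
have [[? N0 N1 ? ?] [[? ? N2 ?] _]] := config_nadjs C.
have [w1 w2 w3 [e1 e2 e3 e4] U Sz _ [ha [hb [q [wq Fq _ ea eb]]]]] := C.
have [N12 _ _] := config_neq C.
move=> x xp; have [->|xam] := eqVneq x am; first by rewrite nadj_sym.
apply/andP; split; first by rewrite N12 // (walk_last w2).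
apply/negP=> E; have [x' [s [t [Ep ws ex wt]]]] := walk_splitr w1 xp xam.
have e1m : e v1 am.
  case: (config_closed1 C) => // E1; move: U; rewrite Ep -catA cat_uniq.
  case/and3P=> _ /hasPn/(_ am); rewrite mem_cat (walk_last wt) => /(_ isT).
  by rewrite -E1 /= (walk_head ws).
apply: (no_longer Sz U Fq
  (L := t ++ (s ++ (rev p2 ++ ([:: a] ++ (q ++ ([:: b] ++ p3))))))); first by wlk.
by rewrite Ep; perm_count.
Qed.

End Rotations.

(** * The three parts are cliques *)

Definition clique_seq p := {in p &, forall x y, x != y -> e x y}.

Section Cliques.

Variables (v1 am a ap bm b bp vk : T) (p1 p2 p3 : seq T).
Hypothesis C : config v1 am a ap bm b bp vk p1 p2 p3.
Hypothesis H_only : only a b.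

Let C' := config_rev C.

Lemma only_nadj z x : z \in H -> x \notin H -> x != a -> x != b -> nadj e z x.
Proof.
move=> zH xH xa xb; apply/andP; split; first by apply: contraNneq xH => <-.
by apply/negP=> /(H_only zH)/(_ xH); rewrite (negPf xa) (negPf xb).
Qed.

Lemma nadj_parts z : z \in H -> {in p1 ++ (p2 ++ p3), forall x, nadj e z x}.
Proof.
move=> zH x xp; have [ab a1 a2 a3 [b1 b2 b3]] := config_notin C.
apply: only_nadj => //.
- apply: contraL xp => /(config_out C); apply: contra; rewrite !mem_cat.
  by case/or3P=> ->; rewrite ?orbT.
- by apply: contraTneq xp => ->; rewrite !mem_cat !negb_or a1 a2 a3.
- by apply: contraTneq xp => ->; rewrite !mem_cat !negb_or b1 b2 b3.
Qed.

(** Two non-adjacent vertices of [p1] would be independent together with [h], [bm] and [vk]. *)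
Lemma part1_clique : clique_seq p1.
Proof.
have [[? ? ? ? ?] [[? ? ? ?] [? ? [? ? ? ?]]]] := config_nadjs C.
move=> x y xp yp xy; apply/negPn/negP=> Nxy; have Nxy' : nadj e x y by apply/andP.
have hx : nadj e h x by apply: nadj_parts; rewrite // mem_cat xp.
have hy : nadj e h y by apply: nadj_parts; rewrite // mem_cat yp.
have := (nadj_last_first C xp, nadj_last_first C yp) => -[? ?].
have := (nadj_first_bm C xp, nadj_first_bm C yp) => -[? ?].
have /negP := free5 h x y bm vk; apply; nadjs.
Qed.

(** Here the other three independent vertices are [h], [v1] and [vk]. *)
Lemma part2_clique : clique_seq p2.
Proof.
have [[? ? ? ? ?] [[? ? ? ?] [? ? [? ? ? ?]]]] := config_nadjs C.
move=> x y xp yp xy; apply/negPn/negP=> Nxy; have Nxy' : nadj e x y by apply/andP.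
have hx : nadj e h x by apply: nadj_parts; rewrite // !mem_cat xp orbT.
have hy : nadj e h y by apply: nadj_parts; rewrite // !mem_cat yp orbT.
have := (nadj_first_middle C xp, nadj_first_middle C yp) => -[? ?].
have xp' : x \in rev p2 by rewrite mem_rev.
have yp' : y \in rev p2 by rewrite mem_rev.
have := (nadj_first_middle C' xp', nadj_first_middle C' yp') => -[? ?].
have /negP := free5 h v1 vk x y; apply; nadjs.
Qed.

End Cliques.

Lemma only_sym a b : only a b -> only b a.
Proof. by move=> Hab z zH w zw wH; rewrite orbC; apply: Hab zH w zw wH. Qed.

Lemma config_facts v1 am a ap bm b bp vk p1 p2 p3 :
  config v1 am a ap bm b bp vk p1 p2 p3 -> only a b ->
  [/\ [/\ clique_seq p1, clique_seq p2 & clique_seq p3],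
      [/\ uniq p1, uniq p2 & uniq p3],
      [/\ {in p1, forall x, nadj e vk x}, {in p2, forall x, nadj e vk x}
        & {in p1, forall x, nadj e x bm}] &
      [/\ {in p3, forall x, nadj e v1 x}, {in p2, forall x, nadj e v1 x}
        & {in p3, forall x, nadj e x ap}]].
Proof.
move=> C Hab; have C' := config_rev C.
have K3 := part1_clique C' (only_sym Hab); have := config_uniq C.
rewrite cat_uniq => /and3P[U1 _]; rewrite cat_uniq => /and3P[_ _].
rewrite cat_uniq => /and3P[U2 _]; rewrite cat_uniq => /and3P[_ _ U3].
split; split=> //.
- exact: part1_clique C Hab.
- exact: part2_clique C Hab.
- by move=> x y xp yp; apply: K3; rewrite mem_rev.
- exact: nadj_last_first C.
- by move=> x xp; apply: (nadj_first_middle C'); rewrite mem_rev.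
- exact: nadj_first_bm C.
- by move=> x xp; apply: (nadj_last_first C'); rewrite mem_rev.
- exact: nadj_first_middle C.
- by move=> x xp; apply: (nadj_first_bm C'); rewrite mem_rev.
Qed.

Lemma walk_loop u p : walk e u u p -> uniq p -> p = [:: u].
Proof.
case: p => // x [|y p] /and3P[/eqP-> /= Hl _] //.
by rewrite -(eqP Hl) mem_last.
Qed.

(** * The path and [H] cover the graph *)

Hypothesis G_bi : forall x, ~~ disconnected e ([set: T] :\ x).

Section Cover.

Variables (v1 am a ap bm b bp vk : T) (p1 p2 p3 : seq T).
Hypothesis C : config v1 am a ap bm b bp vk p1 p2 p3.
Hypothesis H_only : only a b.

(* A vertex z outside P and H sees all of p2 by 5K1-freeness, so p2 has a single
   vertex; that vertex is not an articulation point, so some such z also sees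
   another vertex of P. *)
Lemma config_cover w : (w \in p1 ++ ([:: a] ++ (p2 ++ ([:: b] ++ p3)))) || (w \in H).
Proof.
have [[K1 K2 K3] [U1 U2 U3] [V1 V2 V3] [V4 V5 V6]] := config_facts C H_only.
have [w1 w2 w3 [e1 e2 e3 e4] U Sz out [ha [hb [q [wq Fq qH ea eb]]]]] := C.
set P := p1 ++ _ in U Sz out Fq *.
have [[N1 _ _ _ _] _] := config_nadjs C.
have NF z u v L : z \notin P -> walk e u v L -> perm_eq L ([:: z] ++ P) -> False.
  by move=> zP; apply: no_longer => //; rewrite fresh1.
have NL u v L := @no_longer u v q _ L Sz U Fq.
have [ab _ a2 _ [_ b2 _]] := config_notin C.
have aP : a \in P by rewrite !mem_cat mem_head ?orbT.
have bP : b \in P by rewrite !mem_cat mem_head ?orbT.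
have sub1 x : x \in p1 -> x \in P by rewrite mem_cat => ->.
have sub2 x : x \in p2 -> x \in P by rewrite !mem_cat => ->; rewrite !orbT.
have sub3 x : x \in p3 -> x \in P by rewrite !mem_cat => ->; rewrite !orbT.
pose X := [set z | (z \notin P) && (z \notin H)].
(* A vertex [z] of [X] cannot prolong [P] at an end, so otherwise [h], [z], [v1], [vk], [y] are
   independent. *)
have full z y : z \in X -> y \in p2 -> e z y.
  rewrite inE => /andP[zP zH] yp.
  have ne x : x \in P -> z != x by move=> xP; apply: contraNneq zP => ->.
  have nz x : x \in P -> ~ e z x -> nadj e z x.
    by move=> xP /negP Nx; rewrite /nadj /= ne.
  have hz : nadj e h z.
    by apply: (only_nadj H_only hH zH); apply: ne.
  have zv1 : nadj e z v1.
    apply: nz => [|E]; first by apply/sub1/(walk_head w1).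
    apply: (NF z z vk ([:: z] ++ P) zP _ (perm_refl _)).
    by apply: walk_cat E _; [apply: walk1 | rewrite /P; wlk].
  have zvk : nadj e z vk.
    apply: nz => [|E]; first by apply/sub3/(walk_last w3).
    apply: (NF z v1 z (P ++ [:: z]) zP); last by rewrite perm_catC.
    by rewrite e_sym in E; apply: walk_cat _ E (walk1 _ _); rewrite /P; wlk.
  have := nadj_parts C H_only hH => hN.
  have hv1 : nadj e h v1 by apply: hN; rewrite mem_cat (walk_head w1).
  have hvk : nadj e h vk by apply: hN; rewrite !mem_cat (walk_last w3) !orbT.
  have hy : nadj e h y by apply: hN; rewrite !mem_cat yp orbT.
  have := (V2 y yp, V5 y yp) => -[? ?].
  have [zy|] := boolP (nadj e z y); last first.
    by case/nadjPn=> // E; move: (sub2 _ yp); rewrite -E (negPf zP).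
  have /negP := free5 h z v1 vk y; case; nadjs.
apply: contraT; rewrite negb_or => wX; have {}wX : w \in X by rewrite inE.
have Xout z : z \in X -> z \notin P by rewrite inE => /andP[].
(* Otherwise [w] would fit between [ap] and its successor, both of which it sees. *)
have E2 : ap = bm.
  apply/eqP; apply: contraT => ne.
  have [y [s [t [Ep ws ey wt]]]] := walk_splitr w2 (walk_head w2) ne.
  have ewy : e w y by apply: full; rewrite // Ep mem_cat (walk_head wt) orbT.
  have ewa : e ap w by rewrite e_sym; apply: full wX (walk_head w2).
  case: (NF w v1 vk (p1 ++ ([:: a] ++ (s ++ ([:: w] ++ (t ++ ([:: b] ++ p3))))))).
  - exact: Xout.
  - by wlk.
  - by rewrite /P Ep; perm_count.
have Ep2 : p2 = [:: ap] by apply: walk_loop => //; rewrite {2}E2.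
have mp2 : ap \in p2 by rewrite Ep2 mem_head.
have apP := sub2 _ mp2.
have apa : a != ap by apply: contraNneq a2 => ->.
have wS : w \in [set: T] :\ ap by rewrite !inE andbT; apply: contraNneq (Xout _ wX) => ->.
have aX : a \notin X by rewrite inE aP.
have [z [x [zX xS xX zx]]] := edge_out (y := a) (G_bi ap) wX wS (ltac:(by rewrite !inE apa)) aX.
have zP := Xout _ zX; have zap := full z ap zX mp2; have zbm := zap; rewrite E2 in zbm.
have xH : x \notin H.
  apply/negP=> xH; rewrite e_sym in zx; have zH : z \notin H by move: zX; rewrite inE => /andP[].
  by case/orP: (H_only xH zx zH) zP => /eqP->; rewrite ?aP ?bP.
have xP : x \in P by move: xX; rewrite inE xH andbT negbK.
have zH : z \notin H by move: zX; rewrite inE => /andP[].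
(* When [x] lies in [p1] or [p3], the longer path takes in both the detour and [z]. *)
have Fzq : fresh (q ++ [:: z]) P.
  case/and3P: Fq => _ Uq qP; have zq : z \notin q by apply: contra zH => /qH.
  by rewrite /fresh cat_uniq all_cat Uq qP /= orbF zq zP !andbT; case: (q).
have NF' := NF z; have := xP; rewrite !mem_cat !mem_seq1.
case/or4P=> [xp|/eqP Ex|xp|]; last case/orP=> [/eqP Ex|xp].
- have [v' [p1' [_ w1' pp]]] := clique_walk_from U1 K1 xp.
  case: (no_longer Sz U Fzq (u := vk) (v := v')
    (L := rev p3 ++ ([:: b] ++ (rev q ++ ([:: a] ++ (p2 ++ ([:: z] ++ p1'))))))); first by wlk.
  by rewrite /P; perm_count.
- subst x; case: (NF' v1 vk (p1 ++ ([:: a] ++ ([:: z] ++ (p2 ++ ([:: b] ++ p3))))) zP);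
    first by wlk.
  by rewrite /P; perm_count.
- by move: xS; rewrite Ep2 !inE in xp *; rewrite xp.
- subst x; case: (NF' v1 vk (p1 ++ ([:: a] ++ (p2 ++ ([:: z] ++ ([:: b] ++ p3))))) zP);
    first by wlk.
  by rewrite /P; perm_count.
- have [v' [p3' [_ w3' pp]]] := clique_walk_from U3 K3 xp.
  case: (no_longer Sz U Fzq (u := v1) (v := v')
    (L := p1 ++ ([:: a] ++ (q ++ ([:: b] ++ (rev p2 ++ ([:: z] ++ p3'))))))); first by wlk.
  by rewrite /P; perm_count.
Qed.

End Cover.

(** * No edge joins two of the parts *)

Section Edges.

Variables (v1 am a ap bm b bp vk : T) (p1 p2 p3 : seq T).
Hypothesis C : config v1 am a ap bm b bp vk p1 p2 p3.
Hypothesis H_only : only a b.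

(** The cliques can be crossed between any two of their vertices, so next to another edge [x y] the
    edge from [a] to [am] or to [ap] remains usable, and the detour can be added. *)
Lemma edge12_ends x y : x \in p1 -> y \in p2 -> e x y -> x = am /\ y = ap.
Proof.
move=> xp yp xy.
have [[K1 K2 K3] [U1 U2 U3] [V1 V2 V3] _] := config_facts C H_only.
have [w1 w2 w3 [e1 e2 e3 e4] U Sz out [ha [hb [q [wq Fq qH ea eb]]]]] := C.
have NL u v L := @no_longer u v q _ L Sz U Fq.
have m1 := walk_last w1; have m2 := walk_head w2; have m2' := walk_last w2.
have ybm : y != bm by apply: contraTneq xy => ->; rewrite (nadjNe (V3 x xp)).
have [Ex|xam] := eqVneq x am; last first.
  rewrite eq_sym in xam; have [p1' w1' pp1] := clique_walk U1 K1 m1 xp xam.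
  have [p2' w2' pp2] := clique_walk U2 K2 yp m2' ybm.
  case: (NL hb vk (rev q ++ ([:: a] ++ (p1' ++ (p2' ++ ([:: b] ++ p3)))))); first by wlk.
  by perm_count.
subst x; split=> //; apply/eqP; apply: contraT; rewrite eq_sym => yap.
have [v' [p1' [_ w1' pp1]]] := clique_walk_from U1 K1 m1.
have [p2' w2' pp2] := clique_walk U2 K2 m2 yp yap.
case: (NL vk v' (rev p3 ++ ([:: b] ++ (rev q ++ ([:: a] ++ (p2' ++ p1')))))); first by wlk.
by perm_count.
Qed.

Lemma edge13_end x z : x \in p1 -> z \in p3 -> e x z -> z = bp.
Proof.
move=> xp zp xz; apply/eqP; apply: contraT => zbp.
have [[K1 K2 K3] [U1 U2 U3] _ _] := config_facts C H_only.
have [w1 w2 w3 [e1 e2 e3 e4] U Sz out [ha [hb [q [wq Fq qH ea eb]]]]] := C.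
have [v' [p1' [_ w1' pp1]]] := clique_walk_from U1 K1 xp.
have [p3' w3' pp3] := clique_walk U3 K3 zp (walk_head w3) zbp.
case: (no_longer Sz U Fq (u := v') (v := hb)
  (L := rev p1' ++ (p3' ++ ([:: b] ++ (rev p2 ++ ([:: a] ++ q)))))); first by wlk.
by perm_count.
Qed.

End Edges.

Lemma edge13_ends v1 am a ap bm b bp vk p1 p2 p3 x z :
  config v1 am a ap bm b bp vk p1 p2 p3 -> only a b ->
  x \in p1 -> z \in p3 -> e x z -> x = am /\ z = bp.
Proof.
move=> C Hab xp zp xz; have Ez := edge13_end C Hab xp zp xz; split=> // {Ez}.
rewrite e_sym in xz; rewrite -mem_rev in xp; rewrite -mem_rev in zp.
by have := edge13_end (config_rev C) (only_sym Hab) zp xp xz.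
Qed.

Lemma edge23_ends v1 am a ap bm b bp vk p1 p2 p3 y z :
  config v1 am a ap bm b bp vk p1 p2 p3 -> only a b ->
  y \in p2 -> z \in p3 -> e y z -> y = bm /\ z = bp.
Proof.
move=> C Hab yp zp yz.
rewrite e_sym in yz; rewrite -mem_rev in yp; rewrite -mem_rev in zp.
by have [-> ->] := edge12_ends (config_rev C) (only_sym Hab) zp yp yz.
Qed.

(* Otherwise am, the only vertex of p1 that may see p2 or p3, is an articulation point. *)
Lemma part1_exit v1 am a ap bm b bp vk p1 p2 p3 x0 :
  config v1 am a ap bm b bp vk p1 p2 p3 -> only a b ->
  x0 \in p1 -> x0 != am -> exists x, [/\ x \in p1, x != am & e x a \/ e x b].
Proof.
move=> C Hab xp xam; have [aNb a1 _ _ [b1 _ _]] := config_notin C.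
have Ha : a != am by apply: contraNneq a1 => ->; apply: walk_last (config_walk1 C).
pose X := [set x in p1 | x != am].
have xX : x0 \in X by rewrite inE xp.
have aX : a \notin X by rewrite inE (negPf a1).
have [||z [w [zX wS wX zw]]] := edge_out (G_bi am) xX _ _ aX;
  [by rewrite !inE xam | by rewrite !inE Ha |].
move: zX; rewrite inE => /andP[zp zam]; exists z; split=> //.
have wp1 : w \notin p1 by apply: contra wX => wp; rewrite inE wp; move: wS; rewrite !inE andbT.
have zH : z \notin H by apply/negP=> /(config_out C); rewrite mem_cat zp.
have := config_cover C Hab w; rewrite !mem_cat !mem_seq1 (negPf wp1) /=.
case/orP=> [/or4P[/eqP<-|wp|/eqP<-|wp]|wH]; [by left | | by right | |].
- by have [E _] := edge12_ends C Hab zp wp zw; rewrite E eqxx in zam.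
- by have [E _] := edge13_ends C Hab zp wp zw; rewrite E eqxx in zam.
- rewrite e_sym in zw; case/orP: (Hab _ wH _ zw zH) => /eqP E.
    by rewrite E (negPf a1) in zp.
  by rewrite E (negPf b1) in zp.
Qed.

(** With both edges, all of [p1] fits between [b] and [bp], which frees [a] for the detour. *)
Lemma edge13_no_far_exit v1 am a ap bm b bp vk p1 p2 p3 x :
  config v1 am a ap bm b bp vk p1 p2 p3 -> only a b ->
  e am bp -> x \in p1 -> x != am -> e x b -> False.
Proof.
move=> C Hab E xp xam xb.
have [[K1 K2 K3] [U1 U2 U3] _ _] := config_facts C Hab.
have [w1 w2 w3 [e1 e2 e3 e4] U Sz out [ha [hb [q [wq Fq qH ea eb]]]]] := C.
have [p1' w1' pp1] := clique_walk U1 K1 xp (walk_last w1) xam.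
apply: (no_longer Sz U Fq (u := hb) (v := vk)
  (L := rev q ++ ([:: a] ++ (p2 ++ ([:: b] ++ (p1' ++ p3)))))); first by wlk.
by perm_count.
Qed.

(** The edge must be [am bp]. As [v1] does not see [bp] and [vk] does not see [am], both parts have
    further vertices, hence further exits. These go to [a] from [p1] and to [b] from [p3], and then
    [p1] and [p3] can be traversed between [a] and [b]. *)
Lemma no_edge13 v1 am a ap bm b bp vk p1 p2 p3 :
  config v1 am a ap bm b bp vk p1 p2 p3 -> only a b ->
  {in p1 & p3, forall x z, ~~ e x z}.
Proof.
move=> C Hab x z xp zp; apply/negP=> xz.
have [Ex Ez] := edge13_ends C Hab xp zp xz; subst x z.
have [[_ _ N1 _ _] [[_ N2 _ _] _]] := config_nadjs C.
have [w1 w2 w3 [e1 e2 e3 e4] U Sz out [ha [hb [q [wq Fq qH ea eb]]]]] := C.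
have v1am : v1 != am by apply: contraTneq xz => <-; rewrite (nadjNe N1).
have vkbp : vk != bp by apply: contraTneq xz => <-; rewrite e_sym (nadjNe N2).
have vkp : vk \in rev p3 by rewrite mem_rev (walk_last w3).
have C' := config_rev C; have Hba := only_sym Hab.
have [x [xp1 xam x_ab]] := part1_exit C Hab (walk_head w1) v1am.
have [z [zp3 zbp z_ab]] := part1_exit C' Hba vkp vkbp.
have zx : e bp am by rewrite e_sym.
case: x_ab => [xa|xb]; last exact: (edge13_no_far_exit C Hab xz xp1 xam xb).
case: z_ab => [zb|za]; last exact: (edge13_no_far_exit C' Hba zx zp3 zbp za).
rewrite mem_rev in zp3; rewrite eq_sym in zbp.
have [[K1 K2 K3] [U1 U2 U3] _ _] := config_facts C Hab.
have [p1' w1' pp1] := clique_walk U1 K1 xp1 xp xam.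
have [p3' w3' pp3] := clique_walk U3 K3 zp zp3 zbp.
apply: (no_longer Sz U Fq (u := hb) (v := ap)
  (L := rev q ++ ([:: a] ++ (p1' ++ (p3' ++ ([:: b] ++ rev p2)))))); first by wlk.
by perm_count.
Qed.

Lemma no_edge12 v1 am a ap bm b bp vk p1 p2 p3 :
  config v1 am a ap bm b bp vk p1 p2 p3 -> only a b ->
  {in p1 & p2, forall x y, ~~ e x y}.
Proof.
move=> C Hab x y xp yp; apply/negP=> xy.
have [Ex Ey] := edge12_ends C Hab xp yp xy; subst x y.
have [[_ N1 _ _ _] _] := config_nadjs C.
have [w1 w2 w3 [e1 e2 e3 e4] U Sz out [ha [hb [q [wq Fq qH ea eb]]]]] := C.
have NL u v L := @no_longer u v q _ L Sz U Fq.
have v1am : v1 != am by apply: contraTneq xy => <-; rewrite (nadjNe N1).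
have [x [xp1 xam [xa|xb]]] := part1_exit C Hab (walk_head w1) v1am;
  have [[K1 K2 K3] [U1 U2 U3] _ _] := config_facts C Hab;
  have [p1' w1' pp1] := clique_walk U1 K1 xp1 xp xam.
  case: (NL hb vk (rev q ++ ([:: a] ++ (p1' ++ (p2 ++ ([:: b] ++ p3)))))); first by wlk.
  by perm_count.
have [ab a1 a2 a3 [b1 b2 b3]] := config_notin C.
pose X := [set z in p3].
have bpX : bp \in X by rewrite inE (walk_head w3).
have aX : a \notin X by rewrite inE.
(* Now [x] sees [b], and a second exit of [p3] is needed. Since [p3] may consist of [bp] alone, it
   is found by deleting [b] and not [bp]. *)
have [||z [w [zX wS wX zw]]] := edge_out (G_bi b) bpX _ _ aX.
- by rewrite !inE andbT; apply: contraNneq b3 => <-; apply: walk_head w3.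
- by rewrite !inE ab.
rewrite !inE andbT in zX wS wX.
have zH : z \notin H by apply/negP=> /out; rewrite !mem_cat zX !orbT.
have := config_cover C Hab w; rewrite !mem_cat !mem_seq1 (negPf wS) (negPf wX) /= orbF.
rewrite -!orbA; case/or4P=> [wp|/eqP Ew|wp|wH].
- by rewrite e_sym in zw; move: (no_edge13 C Hab wp zX); rewrite zw.
- subst w; have [v' [p3' [_ w3' pp3]]] := clique_walk_from U3 K3 zX.
  case: (NL bm v' (rev p2 ++ (rev p1' ++ ([:: b] ++ (rev q ++ ([:: a] ++ p3')))))); first by wlk.
  by perm_count.
- rewrite e_sym in zw; have [Ew Ez] := edge23_ends C Hab wp zX zw; subst w z.
  case: (NL vk a (rev p3 ++ (rev p2 ++ (rev p1' ++ ([:: b] ++ (rev q ++ [:: a])))))).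
    by wlk.
  by perm_count.
- rewrite e_sym in zw; case/orP: (Hab _ wH _ zw zH) => /eqP E.
    by rewrite E (negPf a3) in zX.
  by rewrite E (negPf b3) in zX.
Qed.

(** * Four components, and the case without articulation points *)

Lemma components_ge (S : {set T}) s : {subset s <= S} ->
  pairwise [rel x y | y \notin component e S x] s -> size s <= #|components e S|.
Proof.
move=> sS Hs; rewrite -(size_map (component e S)).
have Us : uniq (map (component e S) s).
  rewrite uniq_pairwise pairwise_map; move: Hs.
  apply: (sub_in_pairwise (P := [in S])); last exact/allP.
  by move=> x y xS yS /=; apply: contraNneq => ->; apply: component_refl.
rewrite -(card_uniqP Us); apply/subset_leq_card/subsetP=> D /mapP[x xs ->].
by apply/componentsP; exists x => //; apply: sS.
Qed.

Lemma config_components v1 am a ap bm b bp vk p1 p2 p3 :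
  config v1 am a ap bm b bp vk p1 p2 p3 -> only a b ->
  [/\ a != b, vertex_cut e [set: T] [set a; b] &
      4 <= #|components e ([set: T] :\: [set a; b])|].
Proof.
move=> C Hab; have [ab a1 a2 a3 [b1 b2 b3]] := config_notin C.
have [w1 w2 w3 _ _ _ out _] := C.
have [N12 N13 N23] := config_neq C.
set S := [set: T] :\: [set a; b].
have inS x : (x \in S) = (x != a) && (x != b) by rewrite !inE andbT negb_or.
have H3 := no_edge12 (config_rev C) (only_sym Hab).
have mem_a p x : x \in p -> a \notin p -> x != a by move=> xp; apply: contraNneq => <-.
have mem_b p x : x \in p -> b \notin p -> x != b by move=> xp; apply: contraNneq => <-.
have outH x p : x \in p -> {subset p <= p1 ++ ([:: a] ++ (p2 ++ ([:: b] ++ p3)))} -> x \notin H.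
  by move=> xp pP; apply/negP=> /out; rewrite pP.
have H1 : {in p1, forall x, x \notin H}.
  by move=> x xp; apply: (outH x p1) => // y; rewrite !mem_cat => ->.
have H2 : {in p2, forall x, x \notin H}.
  by move=> x xp; apply: (outH x p2) => // y; rewrite !mem_cat => ->; rewrite !orbT.
have H4 : {in p3, forall x, x \notin H}.
  by move=> x xp; apply: (outH x p3) => // y; rewrite !mem_cat => ->; rewrite !orbT.
have Hclosed : {in H & S, forall z w, e z w -> w \in H}.
  move=> z w zH; rewrite inS => /andP[wa wb] zw; apply: contraT => /(Hab z zH w zw).
  by rewrite (negPf wa) (negPf wb).
have cover w : w \in S -> [\/ w \in p1, w \in p2, w \in p3 | w \in H].
  rewrite inS => /andP[wa wb]; have := config_cover C Hab w.
  rewrite !mem_cat !mem_seq1 (negPf wa) (negPf wb) /= -!orbA.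
  by case/or4P; [apply: Or41 | apply: Or42 | apply: Or43 | apply: Or44].
have HS z : z \in H -> z \in S.
  by move=> zH; rewrite inS; apply/andP; split; apply: contraTneq (out z zH) => ->;
    rewrite !mem_cat mem_head ?orbT.
have noH x w : x \in S -> w \in H -> x \notin H -> e x w -> False.
  by move=> xS wH xH; rewrite e_sym => /(Hclosed _ _ wH xS); rewrite (negPf xH).
have S1 x : x \in p1 -> x \in S by move=> xp; rewrite inS (mem_a p1) ?(mem_b p1).
have S2 x : x \in p2 -> x \in S by move=> xp; rewrite inS (mem_a p2) ?(mem_b p2).
have S3 x : x \in p3 -> x \in S by move=> xp; rewrite inS (mem_a p3) ?(mem_b p3).
have E12 := no_edge12 C Hab; have E13 := no_edge13 C Hab.
have E23 : {in p2 & p3, forall x y, ~~ e x y}.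
  by move=> x y xp yp; rewrite e_sym; apply: H3; rewrite mem_rev.
have closed1 : {in [set x in p1] & S, forall z w, e z w -> w \in [set x in p1]}.
  move=> z w zp wS; rewrite inE in zp; rewrite inE; case: (cover w wS) => [//|wp|wp|wH] zw.
  - by move: (E12 _ _ zp wp); rewrite zw.
  - by move: (E13 _ _ zp wp); rewrite zw.
  - by case: (noH z w (S1 _ zp) wH (H1 _ zp) zw).
have closed2 : {in [set x in p2] & S, forall z w, e z w -> w \in [set x in p2]}.
  move=> z w zp wS; rewrite inE in zp; rewrite inE; case: (cover w wS) => [wp|//|wp|wH] zw.
  - by move: (E12 _ _ wp zp); rewrite e_sym zw.
  - by move: (E23 _ _ zp wp); rewrite zw.
  - by case: (noH z w (S2 _ zp) wH (H2 _ zp) zw).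
have m1 := walk_head w1; have m2 := walk_head w2; have m3 := walk_head w3.
have sub (X : {set T}) x y : {in X & S, forall z w, e z w -> w \in X} -> x \in X -> y \notin X ->
    y \notin component e S x.
  by move=> cX xX; apply: contra => yC; apply: (subsetP (component_closed cX xX)).
have sub1 y : y \notin p1 -> y \notin component e S v1.
  by move=> yp; apply: (sub [set x in p1]) => //; rewrite inE.
have sub2 y : y \notin p2 -> y \notin component e S ap.
  by move=> yp; apply: (sub [set x in p2]) => //; rewrite inE.
have n12 x : x \in p2 -> x \notin p1.
  by move=> xp; apply/negP=> xp'; move: (N12 _ _ xp' xp); rewrite eqxx.
have n13 x : x \in p3 -> x \notin p1.
  by move=> xp; apply/negP=> xp'; move: (N13 _ _ xp' xp); rewrite eqxx.
have n23 x : x \in p3 -> x \notin p2.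
  by move=> xp; apply/negP=> xp'; move: (N23 _ _ xp' xp); rewrite eqxx.
split=> //.
- rewrite /vertex_cut subsetT /=; apply: (closed_disconnected Hclosed hH (y := v1)).
  + exact: HS.
  + exact: S1.
  + exact: H1.
(* Each representative is tested only against later ones, so in this order the closures of [H], [p1]
   and [p2] suffice. *)
- apply: (components_ge (s := [:: h; v1; ap; bp])).
    by move=> x; rewrite !mem_seq4 => /or4P[]/eqP->; auto.
  have hN y : y \notin H -> y \notin component e S h by apply: (sub H).
  have := (H1 _ m1, H2 _ m2, H4 _ m3, n12 _ m2, n13 _ m3, n23 _ m3) => -[[[[[? ?] ?] ?] ?] ?].
  by rewrite /= !hN ?sub1 ?sub2.
Qed.

End TwoAttachments.

Lemma biconnected_ham (T : finType) (e : rel T) :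
  symmetric e -> irreflexive e ->
  connected e [set: T] -> kK1_free e 5 [set: T] ->
  (forall x, ~~ articulation_point e [set: T] x) ->
  (forall x y, x != y -> vertex_cut e [set: T] [set x; y] ->
     #|components e ([set: T] :\: [set x; y])| <= 3) ->
  has_ham_path e [set: T].
Proof.
move=> e_sym e_irr G_conn G_free Nart G_cut.
have G_bi x : ~~ disconnected e ([set: T] :\ x).
  by have := Nart x; rewrite /articulation_point in_setT.
pose P s := sorted e s && uniq s.
have [|s /andP[Hs Us] max] := longest_uniq (isT : P [::]); first by move=> ? /andP[].
have [/forallP Ms|/forallPn[h hs]] := boolP [forall z, z \in s].
  by exists s; split=> // z; rewrite Ms inE.
(* A longest path is non-empty because [[:: h]] is a path. *)
have [u [v ws]] : exists u v, walk e u v s.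
  case: s Hs {Us} max {hs} => [|x s] Hs max; last by exists x, (last x s); apply: sorted_walk.
  by have := max [:: h] isT.
pose D := [set y | y \notin s]; pose H := component e D h.
have hD : h \in D by rewrite inE.
have hH : h \in H by apply: component_refl.
have out : {in H, forall z, z \notin s}.
  by move=> z /(subsetP (component_sub _ _ _)); rewrite inE.
have att : {in H, forall z w, e z w -> w \notin H -> w \in s}.
  move=> z zH w zw; apply: contraR => wD.
  by apply: component_adj zw; rewrite // inE.
have longest u' v' p : walk e u' v' p -> uniq p -> size p <= size s.
  by move=> wp Up; apply: max; rewrite /P Up (walk_sorted wp).
have Hwalk : {in H &, forall y z, exists q, [/\ walk e y z q, uniq q & {subset q <= H}]}.
  by move=> y z yH zH; apply: component_walk.
have [am [a [ap [bm [b [bp [p1 [p2 [p3 [C Hab]]]]]]]]]] :=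
  two_attached e_sym G_free longest Hwalk hH G_conn G_bi ws Us erefl out att.
have [ab cut] := config_components e_sym G_free longest Hwalk hH G_bi C Hab.
by rewrite ltnNge G_cut.
Qed.

Theorem theorem7 (T : finType) (e : rel T)
    (e_sym : symmetric e) (e_irr : irreflexive e)
    (G_conn : connected e [set: T]) (G_free : kK1_free e 5 [set: T]) :
  has_ham_path e [set: T] <->
  [/\ (* (a) *)
      forall x : T, articulation_point e [set: T] x ->
        #|components e ([set: T] :\ x)| <= 2,
      (* (b) *)
      ~ (exists x y z : T,
           [/\ articulation_point e [set: T] x,
               articulation_point e [set: T] y
             & articulation_point e [set: T] z]
           /\ [/\ e x y, e y z & e x z]),
      (* (c) *)
      ~~ k_connected e 2 [set: T] ->
        forall (x : T) (Q1 Q2 : {set T}),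
          articulation_point e [set: T] x ->
          Q1 != Q2 -> components e ([set: T] :\ x) = [set Q1; Q2] ->
          clique e Q1 -> kK1_free e 4 Q2 ->
          exists u : T, [/\ u \in Q2, e x u & has_ham_path_from e Q2 u]
    & (* (d) *)
      k_connected e 2 [set: T] -> ~~ k_connected e 3 [set: T] ->
        forall x y : T, minimum_vertex_cut e [set: T] [set x; y] ->
          #|components e ([set: T] :\: [set x; y])| <= 3].
Proof.
split=> [[p Hp]|[Ha _ Hc Hd]].
  split.
  - by move=> x _; apply: ham_articulation Hp.
  - move=> [x [y [z [[ax ay az] [xy yz xz]]]]].
    exact: (ham_no_articulation_triangle e_sym e_irr Hp ax ay az xy yz xz).
  - by move=> _ x Q1 Q2 _ Q12 HQ _ _; apply: (ham_pendant e_sym Hp Q12 HQ).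
  - by move=> _ _ x y _; apply: ham_cut2 Hp.
have [/existsP[x ax]|/existsPn Nart] := boolP [exists x, articulation_point e [set: T] x].
  apply: (articulation_ham e_sym e_irr G_conn G_free Ha _ ax) => y Q1 Q2.
  exact/Hc/(articulation_not_2connected ax).
apply: biconnected_ham => // x y xy cut.
have [k2 mincut] := minimum_cut2 G_conn Nart xy cut.
(* The cut itself bounds the connectivity by two, so the graph is not 3-connected. *)
apply: Hd => //; rewrite -ltnNge ltnS; apply: leq_trans (vertex_connectivity_le cut) _.
by rewrite cards2 xy.
Qed.
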